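(* Let $1<s<\infty$ and let $s'$ be the conjugate exponent of $s$, $1/s+1/s'=1$. Then there is a constant $c$ (independent of $f$ and $t$) such that for every $f\in X_s(\mathbb{R}^n)$ and every $t>0$, $$K(t,f;H^1,L^1)\le c\,\min\big(t,\,t^{1/s'}\big)\,\|f\|_{X_s}.$$
   Context: For $1<q\le 2$ with conjugate exponent $2\le p<\infty$, $1/p+1/q=1$, and $0<s\le\infty$ (with $1/\infty=0$), a compactly supported function $a$ on $\mathbb{R}^n$ is a $(q,s)$ atom with defining cube $Q$ if $\mathrm{supp}(a)\subseteq Q$, $\int_Q a(x)\,dx=0$, and $$p^{1/s}\,|Q|\left(\frac1{|Q|}\int_Q|a(x)|^q\,dx\right)^{1/q}\le 1 .$$ $\mathcal{A}_s$ denotes the collection of all $(q,s)$ atoms, over all $1<q\le 2$ and all cubes $Q$; it is contained in the unit ball of $L^1(\mathbb{R}^n)$. The space $X_s=X_s(\mathbb{R}^n)$ consists of all $f\in L^1(\mathbb{R}^n)$ of the form $f=\sum_j\lambda_j a_j$ (convergence in $L^1$) with $a_j\in\mathcal{A}_s$ and $\sum_j|\lambda_j|<\infty$, normed by $\|f\|_{X_s}=\inf\sum_j|\lambda_j|$, the infimum being over all such decompositions of $f$. $H^1=H^1(\mathbb{R}^n)$ is the (real) Hardy space and $L^1=L^1(\mathbb{R}^n)$. The Peetre $K$ functional is $K(t,f;H^1,L^1)=\inf\{\|f_1\|_{H^1}+t\,\|f_2\|_{L^1}: f=f_1+f_2,\ f_1\in H^1,\ f_2\in L^1\}$. *)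

(* Defs.v *)
From HB Require Import structures.
From mathcomp Require Import all_boot all_order all_algebra.
From mathcomp Require Import all_classical all_reals all_analysis.

Set Implicit Arguments.
Unset Strict Implicit.
Unset Printing Implicit Defensive.
Import Order.TTheory GRing.Theory Num.Theory.
Import numFieldNormedType.Exports.

Local Open Scope classical_set_scope.
Local Open Scope ring_scope.

(* 'rV[R]_n carries the product sigma-algebra (that of the coordinates, i.e.  *)
(* the Borel one), exactly as the library does for n.-tuple R.                *)
Section measurable_rV.
Context {R : realType} {n : nat}.

Let coors : 'I_n -> 'rV[R]_n -> R := fun i x => x ord0 i.

Let rV_set0 : g_sigma_preimage coors set0.
Proof. exact: sigma_algebra0. Qed.

Let rV_setC A : g_sigma_preimage coors A -> g_sigma_preimage coors (~` A).
Proof. exact: sigma_algebraC. Qed.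

Let rV_bigcup (F : _^nat) : (forall i, g_sigma_preimage coors (F i)) ->
  g_sigma_preimage coors (\bigcup_i (F i)).
Proof. exact: sigma_algebra_bigcup. Qed.

HB.instance Definition _ := @isMeasurable.Build
  (measure_tuple_display default_measure_display)
  'rV[R]_n (g_sigma_preimage coors) rV_set0 rV_setC rV_bigcup.

End measurable_rV.

Lemma measurable_coord (R : realType) n (i : 'I_n) :
  measurable_fun [set: 'rV[R]_n] (fun x : 'rV[R]_n => x ord0 i).
Proof.
move=> _ Y mY; rewrite setTI; apply: sub_sigma_algebra => /=.
rewrite -bigcup_seq/=; exists i => /=; first by rewrite mem_index_enum.
by exists Y => //; rewrite setTI.
Qed.

Lemma measurable_fun_rVP d (T : measurableType d) (R : realType) n
    (f : T -> 'rV[R]_n) :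
  (forall i, measurable_fun [set: T] (fun t => f t ord0 i)) ->
  measurable_fun [set: T] f.
Proof.
move=> mf _ A mA; rewrite setTI; move: A mA.
suff : @measurable _ 'rV[R]_n `<=` [set A | measurable (f @^-1` A)] by [].
apply: smallest_sub.
  split => /=; first by rewrite preimage_set0.
    by move=> A mA; rewrite setTD preimage_setC; exact: measurableC.
  by move=> F mF; rewrite preimage_bigcup; exact: bigcupT_measurable.
move=> A; rewrite -bigcup_seq/= => -[i _ [B mB <-]].
by have := mf i measurableT B mB; rewrite !setTI.
Qed.

Section lebesgue_rV.
Context {R : realType}.

Definition rV_cons n (p : measurableTypeR R * 'rV[R]_n) : 'rV[R]_n.+1 :=
  \row_i oapp (p.2 ord0) p.1 (unlift ord0 i).

Lemma measurable_rV_cons n : measurable_fun [set: _] (@rV_cons n).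
Proof.
apply: measurable_fun_rVP => i.
under eq_fun do rewrite mxE.
case: (unlift ord0 i) => [j|] /=; last exact: measurable_fst.
exact: (measurableT_comp (measurable_coord j) measurable_snd).
Qed.

HB.instance Definition _ n := isMeasurableFun.Build _ _ _ _ (@rV_cons n)
  (@measurable_rV_cons n).

Section step.
Context (n : nat) (mu : {sigma_finite_measure set 'rV[R]_n -> \bar R}).

Definition lebesgue_rVS : set 'rV[R]_n.+1 -> \bar R :=
  pushforward (lebesgue_measure \x mu)%E (@rV_cons n).

Let lebesgue_rVS0 : lebesgue_rVS set0 = 0%E.
Proof. exact: measure0. Qed.

Let lebesgue_rVS_ge0 A : (0 <= lebesgue_rVS A)%E.
Proof. exact: measure_ge0. Qed.

Let lebesgue_rVS_sigma_additive : semi_sigma_additive lebesgue_rVS.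
Proof.
exact: (@measure_semi_sigma_additive _ _ _
  (pushforward (lebesgue_measure \x mu)%E (@rV_cons n))).
Qed.

HB.instance Definition _ := isMeasure.Build _ _ _ lebesgue_rVS
  lebesgue_rVS0 lebesgue_rVS_ge0 lebesgue_rVS_sigma_additive.

Let sfin : sigma_finite setT lebesgue_rVS.
Proof.
have /sigma_finiteP[F [TF ndF Foo]] := sigma_finiteT (@lebesgue_measure R).
have /sigma_finiteP[G [TG ndG Goo]] := sigma_finiteT mu.
pose h (v : 'rV[R]_n.+1) : measurableTypeR R * 'rV[R]_n :=
  (v ord0 ord0, \row_j v ord0 (lift ord0 j)).
have mh : measurable_fun setT h.
  apply/measurable_fun_pairP; split; first exact: measurable_coord.
  apply: measurable_fun_rVP => i /=.
  by under eq_fun do rewrite mxE; exact: measurable_coord.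
have hK : cancel (@rV_cons n) h.
  move=> [x v]; rewrite /h /rV_cons mxE unlift_none /=; congr pair.
  by apply/rowP => j; rewrite !mxE liftK.
exists (fun k => h @^-1` (F k `*` G k)).
  apply/seteqP; split=> // v _.
  have [a _ Fa] : (\bigcup_k F k) (h v).1 by rewrite -TF.
  have [b _ Gb] : (\bigcup_k G k) (h v).2 by rewrite -TG.
  exists (maxn a b) => //; split.
    by move: Fa; exact/subsetPset/ndF/leq_maxl.
  by move: Gb; exact/subsetPset/ndG/leq_maxr.
move=> k; have [mF Fk] := Foo k; have [mG Gk] := Goo k; split.
  by rewrite -[_ @^-1` _]setTI; apply: mh => //; exact: measurableX.
rewrite /lebesgue_rVS /pushforward -comp_preimage.
rewrite (_ : h \o _ = id); last by apply/funext => p /=; rewrite hK.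
by rewrite preimage_id product_measure1E// lte_mul_pinfty// ge0_fin_numE.
Qed.

HB.instance Definition _ := Measure_isSigmaFinite.Build _ _ _ lebesgue_rVS sfin.

End step.

(* n-dimensional Lebesgue measure, on Borel sets: mu_(n+1) = mu_1 x mu_n       *)
(* transported along R * R^n ~ R^(n+1); see lebesgue_rV_box for boxes.        *)
Fixpoint lebesgue_rV n : {sigma_finite_measure set 'rV[R]_n -> \bar R} :=
  match n with
  | 0 => \d_(0 : 'rV[R]_0)
  | n.+1 => lebesgue_rVS (lebesgue_rV n)
  end.

End lebesgue_rV.

Lemma lebesgue_rV_box (R : realType) n (A : 'I_n -> set R) :
  (forall i, measurable (A i)) ->
  lebesgue_rV n [set x : 'rV[R]_n | forall i, A i (x ord0 i)] =
  (\prod_(i < n) lebesgue_measure (A i))%E.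
Proof.
elim: n A => [|n IHn] A mA.
  rewrite big_ord0 /= diracE mem_set //=.
  by case.
rewrite big_ord_recl -(IHn (fun i => A (lift ord0 i))) //.
set B := [set x : 'rV[R]_n | _].
have mB : measurable B.
  rewrite (_ : B = \bigcap_(i in [set: 'I_n])
      ((fun x : 'rV[R]_n => x ord0 i) @^-1` A (lift ord0 i))).
    apply: fin_bigcap_measurable => // i _.
    by rewrite -[_ @^-1` _]setTI; exact: measurable_coord.
  by apply/seteqP; split=> [x Ax i _|x Ax i]; exact: Ax.
rewrite -(product_measure1E lebesgue_measure (lebesgue_rV n) (mA ord0) mB).
rewrite /= /lebesgue_rVS /pushforward; apply: (congr1 (lebesgue_measure \x lebesgue_rV n)%E).
apply/seteqP; split=> -[x v] /= => [Axv|[Ax Av] i].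
  split=> [|i]; first by have := Axv ord0; rewrite mxE unlift_none.
  by have := Axv (lift ord0 i); rewrite mxE liftK.
by rewrite mxE; case: unliftP => [j ->|->] /=.
Qed.

Section spaces.
Context {R : realType} {n : nat}.
Local Notation mu := (@lebesgue_rV R n).
Implicit Types (f a : 'rV[R]_n -> R) (Phi : 'rV[R]_n -> R) (Q : set 'rV[R]_n).

Definition L1 : set ('rV[R]_n -> R) :=
  [set f | mu.-integrable [set: 'rV[R]_n] (EFin \o f)].

Definition L1norm f : \bar R := 'N[mu]_1[EFin \o f]%E.

Definition partial (i : 'I_n) f : 'rV[R]_n -> R :=
  fun x => 'D_(delta_mx ord0 i) f x.

(* Membership in the Schwartz class: every iterated partial derivative exists *)
(* everywhere and decays faster than any power of |x|. The norm of 'rV[R]_n   *)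
(* is the sup norm, which is equivalent to the Euclidean one.                 *)
Definition schwartz f : Prop := forall b : seq 'I_n,
  (forall i x, derivable (foldr partial f b) x (delta_mx ord0 i)) /\
  (forall k : nat, exists C : R, forall x,
    `|x| ^+ k * `|foldr partial f b x| <= C).

(* sup_(t > 0) |(f * Phi_t) x|, where Phi_t y = t^(-n) Phi (y / t)            *)
Definition maximal_fun Phi f (x : 'rV[R]_n) : \bar R :=
  ereal_sup [set `|\int[mu]_y (t ^- n * Phi (t^-1 *: (x - y)) * f y)%:E|%E
            | t in [set t : R | 0 < t]].

(* The real Hardy space, by the Fefferman-Stein maximal function attached to  *)
(* a Schwartz function Phi with nonzero integral. The space does not depend   *)
(* on Phi; the norm does, but only up to equivalence.                         *)
Definition H1norm Phi f : \bar R := (\int[mu]_x maximal_fun Phi f x)%E.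

Definition H1 Phi : set ('rV[R]_n -> R) :=
  [set f | L1 f /\ (H1norm Phi f < +oo)%E].

(* Elements of L^1 are represented by functions, so that a decomposition is   *)
(* an equality almost everywhere.                                             *)
Definition K_functional Phi (t : R) f : \bar R :=
  ereal_inf [set r : \bar R | exists f1 f2,
    [/\ H1 Phi f1, L1 f2, (f = f1 \+ f2 %[ae mu])
      & r = (H1norm Phi f1 + t%:E * L1norm f2)%E]].

Definition cube (z : 'rV[R]_n) (l : R) : set 'rV[R]_n :=
  [set x | forall i, z ord0 i <= x ord0 i <= z ord0 i + l].

Definition is_cube Q : Prop := exists z l, 0 < l /\ Q = cube z l.

(* a is a (q, s) atom with defining cube Q, and p is the conjugate of q       *)
Definition atom (p q s : R) Q a : Prop :=
  [/\ measurable_fun [set: 'rV[R]_n] a,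
      closure [set x | a x != 0] `<=` Q,
      (\int[mu]_(x in Q) (a x)%:E = 0)%E
    & ((p `^ s^-1)%:E * mu Q *
        ((mu Q)^-1 * \int[mu]_(x in Q) (`|a x| `^ q)%:E) `^ q^-1 <= 1)%E].

Definition atoms (s : R) : set ('rV[R]_n -> R) :=
  [set a | exists p q Q,
    [/\ 1 < q <= 2, p^-1 + q^-1 = 1, is_cube Q & atom p q s Q a]].

Definition atomic_dec (s : R) f (lam : nat -> R) (a : nat -> 'rV[R]_n -> R) :=
  [/\ forall j, atoms s (a j),
      (\sum_(0 <= j <oo) `|lam j|%:E < +oo)%E
    & L1norm (fun x => f x - \sum_(j < N) lam j * a j x) @[N --> \oo] --> 0%E].

Definition Xspace (s : R) : set ('rV[R]_n -> R) :=
  [set f | L1 f /\ exists lam (a : nat -> 'rV[R]_n -> R), atomic_dec s f lam a].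

Definition Xnorm (s : R) f : \bar R :=
  ereal_inf [set r : \bar R | exists lam (a : nat -> 'rV[R]_n -> R),
    atomic_dec s f lam a /\ r = (\sum_(0 <= j <oo) `|lam j|%:E)%E].

End spaces.

(* Main.v *)
Require Import Defs.
From mathcomp Require Import all_boot all_order all_algebra.
From mathcomp Require Import all_classical all_reals all_analysis.
From mathcomp Require Import measurable_realfun.
From mathcomp Require Import lra.

Import Order.TTheory GRing.Theory Num.Theory.
Import numFieldNormedType.Exports.

Local Open Scope classical_set_scope.
Local Open Scope ring_scope.

(** A (q, s) atom with conjugate exponent p has L^1 norm at most 2 p^(-1/s) and
    H^1 norm at most C p p^(-1/s) = C p^(1/s'), with C depending on neither q nor
    the atom. Given t > 0, an atomic decomposition of f is therefore split
    according to the size of p: the atoms with p <= t are summed in H^1, each at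
    a cost C p^(1/s') <= C t^(1/s'), the atoms with p > t are left in L^1, each at
    a cost 2 t p^(-1/s) <= 2 t^(1/s'). Both costs are also O(t): p^(-1/s) <= 1, and
    in the first case p <= t. Summing against the coefficients and taking the
    infimum over all decompositions of f gives the result
    ([K_functional_atomic_le]).

    The point is the linear growth in p of the H^1 norm ([atom_maximal_le]).
    Let Q be the cube of the atom a, of side l and corner z, and let
    lam = p^(-1/s) / |Q|, so that the mean of |a|^q over Q is at most lam^q.

    - Far from Q the mean value zero of a and the decay of the gradient of the
      kernel Phi bound the maximal function by C l |x - z|^(-n-1) times the L^1
      norm of a ([dilate_conv_far_le]), which is integrable in x.

    - Near Q the maximal function is dominated by the Hardy-Littlewood maximal
      function M a ([dilate_conv_le]), and M a is at most lam plus the sum over k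
      of 2^k lam times the indicator function of {M a > 2^k lam}
      ([ball_integral_le]). The weak type inequality, combined with
      |a| <= kappa + kappa^(1-q) |a|^q, bounds the measure of {M a > lam'} by
      C lam'^(-q) times the integral of |a|^q ([superlevel_weak_type]). The sum
      over k is then geometric of ratio 2^(1-q), and
      1 / (1 - 2^(1-q)) <= 3 / (q - 1) <= 3 p ([integral_level_excess_le]).

    The Fefferman-Stein maximal function is a supremum over an uncountable set
    of dilations. Every estimate of its integral goes through a measurable
    majorant built from countably many balls, so its own measurability is
    never at stake ([lower_integral_le]). *)

Set Implicit Arguments.
Unset Strict Implicit.
Unset Printing Implicit Defensive.

(** * Balls and Borel sets of the space of row vectors *)

Section rV_geometry.
Context {R : realType} {n : nat}.
Implicit Types (x y c : 'rV[R]_n) (r e : R).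

Lemma ball_rVE x r : 0 < r ->
  ball x r = [set y : 'rV[R]_n | forall i, ball (x ord0 i) r (y ord0 i)].
Proof.
move=> r0; apply/seteqP; split => [y [_ yx] i|y yx]; first exact: yx.
by split => // i j; rewrite ord1.
Qed.

Lemma measurable_ball_rV x r : measurable (ball x r).
Proof.
have [r0|r0] := ltP 0 r; last first.
  by rewrite (_ : ball x r = set0)// -subset0 => y []; rewrite ltNge r0.
have -> : ball x r = \bigcap_(i in [set: 'I_n])
    ((fun y : 'rV[R]_n => y ord0 i) @^-1` ball (x ord0 i) r).
  rewrite ball_rVE//.
  by apply/seteqP; split=> [y Ay i _|y Ay i]; exact: Ay.
apply: fin_bigcap_measurable => // i _; rewrite -[_ @^-1` _]setTI.
by apply: measurable_coord => //; rewrite ball_itv; exact: measurable_itv.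
Qed.

Lemma lebesgue_rV_ball x r : 0 < r ->
  lebesgue_rV n (ball x r) = ((r *+ 2) ^+ n)%:E.
Proof.
move=> r0; rewrite ball_rVE// (lebesgue_rV_box (A := fun i => ball (x ord0 i) r)).
  under eq_bigr do rewrite lebesgue_measure_ball ?ltW//.
  by rewrite prodEFin prodr_const card_ord.
by move=> i; rewrite ball_itv; exact: measurable_itv.
Qed.

Lemma coord_le_norm x i : `|x ord0 i| <= `|x|.
Proof.
rewrite [leRHS]/Num.Def.normr /= mx_normrE.
by apply/bigmax_geP; right => /=; exists (ord0, i).
Qed.

Lemma norm_rV_le x e : 0 <= e -> (forall i, `|x ord0 i| <= e) -> `|x| <= e.
Proof.
move=> e0 xe; rewrite [leLHS]/Num.Def.normr /= mx_normrE.
by apply/bigmax_leP; split => // -[i j] _ /=; rewrite ord1.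
Qed.

(** The countable family of balls that replaces all balls in the maximal
    function and in the description of open sets. *)
Definition rational_ball (i : 'rV[rat]_n * rat) : set 'rV[R]_n :=
  ball (map_mx ratr i.1 : 'rV[R]_n) (ratr i.2 : R).

(** The factor 3 leaves room to move the centre by less than r to a rational
    point and to keep a radius of more than 2 r. *)
Lemma rational_ball_sandwich x r : 0 < r -> exists i,
  [/\ ball x r `<=` rational_ball i, 0 < (ratr i.2 : R) & (ratr i.2 : R) < r *+ 3].
Proof.
move=> r0.
have [q q2r] : exists q : rat, r *+ 2 < ratr q < r *+ 3.
  have /rat_in_itvoo[q] : r *+ 2 < r *+ 3 by rewrite ltr_pMn2l.
  by rewrite in_itv/= => ?; exists q.
have /choice[c cx] (j : 'I_n) : exists c : rat, x ord0 j - r < ratr c < x ord0 j + r.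
  have /rat_in_itvoo[c] : x ord0 j - r < x ord0 j + r.
    by rewrite ltrBlDr -addrA ltrDl addr_gt0.
  by rewrite in_itv/= => ?; exists c.
case/andP: q2r => rq qr.
have q0 : 0 < (ratr q : R) by rewrite (lt_trans _ rq)// mulrn_wgt0.
exists (\row_j c j, q); split => //=.
rewrite /rational_ball /= !ball_rVE// => y /= xy j; rewrite !mxE.
have := xy j; have := cx j; rewrite /ball/= distrC => /andP[? ?].
rewrite !ltr_distlC/= => /andP[? ?].
rewrite mulr2n in rq; apply/andP; split; lra.
Qed.

Lemma open_measurable_rV (U : set 'rV[R]_n) : open U -> measurable U.
Proof.
move=> oU; have -> : U = \bigcup_(i : 'rV[rat]_n * rat)
    (if `[< rational_ball i `<=` U >] then rational_ball i else set0).
  apply/seteqP; split => [x Ux|x [i _]]; last first.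
    by case: ifPn => // /asboolP; apply.
  have /nbhs_ballP[e /= e0 xe] := open_nbhs_nbhs (conj oU Ux).
  have e60 : 0 < e / 6 by rewrite divr_gt0.
  have [i [xi i0 ie]] := rational_ball_sandwich x e60.
  have ix := xi x (ballxx x e60).
  exists i => //; case: ifPn => // /asboolPn; apply: contra_notP => _.
  move=> y iy; apply: xe; apply: (@le_ball _ _ _ (ratr i.2 + ratr i.2)).
    by move: ie; rewrite -mulr_natl; lra.
  exact: ball_triangle (ball_sym ix) iy.
apply: countable_bigcupT_measurable => [|i]; first exact: countableP.
case: ifPn => // _.
exact: measurable_ball_rV.
Qed.

Lemma continuous_measurable_rV (f : 'rV[R]_n -> R) :
  continuous f -> measurable_fun setT f.
Proof.
move=> /continuousP cf.
apply: (measurability _ (RGenOpens.measurableE R)).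
move=> _ [_ [a [b ->]] <-]; rewrite setTI.
by apply: open_measurable_rV; apply: cf; exact: interval_open.
Qed.

End rV_geometry.

(** * A covering estimate of Vitali type *)

Section covering.
Context {R : realType} {n : nat}.
Local Notation mu := (@lebesgue_rV R n).
Implicit Types (b c : 'rV[R]_n * R) (s : seq ('rV[R]_n * R)).
Implicit Types (h : 'rV[R]_n -> \bar R).

Definition ball_union s : set 'rV[R]_n :=
  \bigcup_(b in [set` s]) ball b.1 b.2.

Lemma measurable_ball_union s : measurable (ball_union s).
Proof.
rewrite /ball_union bigcup_seq.
by apply: bigsetU_measurable => b _; exact: measurable_ball_rV.
Qed.

(** Vitali's selection, carried out inside the estimate. The largest ball of
    the list, once tripled, covers all the balls that meet it; the balls that do
    not meet it are handled by induction, and the integral of h over them adds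
    up with the integral over the largest ball because the domains are disjoint. *)
Lemma ball_union_le h (k : R) s :
  measurable_fun [set: 'rV[R]_n] h -> (forall x, 0 <= h x)%E -> 0 <= k ->
  {in s, forall b, 0 < b.2 /\
    (k%:E * mu (ball b.1 b.2) <= \int[mu]_(x in ball b.1 b.2) h x)%E} ->
  (k%:E * mu (ball_union s) <= (3 ^+ n)%:E * \int[mu]_(x in ball_union s) h x)%E.
Proof.
move=> mh h0 k0.
pose larger b c := c.2 <= b.2.
have larger_trans : transitive larger by move=> x y z /[swap]; exact: le_trans.
wlog sorted_s : s / sorted larger s.
  move=> wl hs; rewrite (_ : ball_union s = ball_union (sort larger s)).
    apply: wl => [|b]; last by rewrite mem_sort; exact: hs.
    by apply: sort_sorted => b c; exact: le_total.
  by apply/seteqP; split => x [b /= bs xb]; exists b => //=;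
    move: bs; rewrite mem_sort.
move: {2}(size s) (leqnn (size s)) => m.
elim: m s sorted_s => [|m IH] [|b s]//= sorted_s sm hs.
- rewrite (_ : ball_union [::] = set0); last by rewrite /ball_union bigcup_seq big_nil.
  by rewrite measure0 mule0 integral_set0 mule0.
- rewrite (_ : ball_union [::] = set0); last by rewrite /ball_union bigcup_seq big_nil.
  by rewrite measure0 mule0 integral_set0 mule0.
have [b0 hb] := hs b (mem_head _ _).
pose s' := [seq c <- s | `[< ball c.1 c.2 `&` ball b.1 b.2 = set0 >]].
have bs : {in s, forall c, c.2 <= b.2}.
  by move=> c cs; apply: (allP (order_path_min larger_trans sorted_s)).
have ss' : {subset s' <= s} by move=> c; rewrite mem_filter => /andP[].
have hs' : (k%:E * mu (ball_union s') <=
    (3 ^+ n)%:E * \int[mu]_(x in ball_union s') h x)%E.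
  apply: IH => [||c /ss' cs].
  - by apply: sorted_filter => //; exact: path_sorted sorted_s.
  - by rewrite size_filter (leq_trans (count_size _ _)).
  - by apply: hs; rewrite in_cons cs orbT.
have cover : ball_union (b :: s) `<=` ball b.1 (b.2 *+ 3) `|` ball_union s'.
  move=> x [c /=]; rewrite in_cons => /predU1P[->|cs] cx.
    by left; apply: le_ball cx; lra.
  have [cb|/asboolPn] := pselect (ball c.1 c.2 `&` ball b.1 b.2 = set0).
    by right; exists c => //=; rewrite mem_filter cs andbT; exact/asboolP.
  move=> /asboolPn/eqP/set0P[y [cy yb]]; left.
  have -> : b.2 *+ 3 = b.2 + (b.2 + b.2) by lra.
  apply: ball_triangle yb _; apply: (@le_ball _ _ _ (c.2 + c.2)).
    by rewrite lerD// bs.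
  by apply: ball_triangle cx; exact: ball_sym.
have disj : [disjoint ball b.1 b.2 & ball_union s'].
  apply/disj_setPS => y [yb [c /=]]; rewrite mem_filter => /andP[/asboolP cb _] yc.
  by suff : set0 y by []; rewrite -cb; split.
have mb r : measurable (ball b.1 r) by exact: measurable_ball_rV.
apply: (@le_trans _ _ (k%:E * (mu (ball b.1 (b.2 *+ 3)) + mu (ball_union s')))%E).
  apply: lee_wpmul2l; first by rewrite lee_fin.
  apply: le_trans (measureU2 _ _ _) => //; last exact: measurable_ball_union.
  apply: le_measure => //; rewrite inE; first exact: measurable_ball_union.
  by apply: measurableU => //; exact: measurable_ball_union.
rewrite ge0_muleDr//.
apply: (@le_trans _ _ ((3 ^+ n)%:E * (\int[mu]_(x in ball b.1 b.2) h x +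
    \int[mu]_(x in ball_union s') h x))%E).
  rewrite ge0_muleDr ?integral_ge0//; apply: leeD => //.
  rewrite (_ : mu _ = (3 ^+ n)%:E * mu (ball b.1 b.2))%E.
    by rewrite muleCA; apply: lee_wpmul2l => //; rewrite lee_fin exprn_ge0.
  rewrite !lebesgue_rV_ball ?mulrn_wgt0// -EFinM -exprMn.
  by rewrite (_ : b.2 *+ 3 *+ 2 = 3 * (b.2 *+ 2))//; lra.
apply: lee_wpmul2l; first by rewrite lee_fin exprn_ge0.
have ms' := measurable_ball_union s'.
rewrite -ge0_integral_setU//; last exact: measurable_funTS.
apply: ge0_subset_integral => //.
- exact: measurableU.
- exact: measurable_ball_union.
- exact: measurable_funTS.
- move=> x [xb|[c /ss' cs xc]]; first by exists b => //=; exact: mem_head.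
  by exists c => //=; rewrite in_cons cs orbT.
Qed.

(** The constant does not depend on the number of balls, so the finite estimate
    passes to the increasing limit. *)
Lemma bigcup_ball_le h (k : R) (I : countType) (B : I -> 'rV[R]_n * R) (P : set I) :
  measurable_fun [set: 'rV[R]_n] h -> (forall x, 0 <= h x)%E -> 0 <= k ->
  (forall i, P i -> 0 < (B i).2 /\
    (k%:E * mu (ball (B i).1 (B i).2) <=
     \int[mu]_(x in ball (B i).1 (B i).2) h x)%E) ->
  (k%:E * mu (\bigcup_(i in P) ball (B i).1 (B i).2) <=
    (3 ^+ n)%:E * \int[mu]_x h x)%E.
Proof.
move=> mh h0 k0 hP.
pose f m := obind (fun i => if `[< P i >] then Some (B i) else None) (pickle_inv m).
pose F N := ball_union (pmap f (iota 0 N)).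
have FP N b : b \in pmap f (iota 0 N) <->
    exists i, [/\ P i, B i = b & (@pickle I i < N)%N].
  rewrite mem_pmap; split=> [/mapP[m]|[i [Pi <- iN]]]; last first.
    apply/mapP; exists (pickle i); first by rewrite mem_iota.
    by rewrite /f pickleK_inv /=; case: ifPn => // /asboolPn.
  rewrite mem_iota /= add0n /f => mN; case mi : (pickle_inv m) => [i|]//=.
  have := @pickle_invK I m; rewrite mi /= => im.
  by case: ifPn => // /asboolP Pi [->]; exists i; rewrite im.
have Fsub m N : (m <= N)%N -> F m `<=` F N.
  move=> mN x [b /= /FP[i [Pi Bi im]] bx]; exists b => //=.
  by apply/FP; exists i; rewrite (leq_trans im).
have -> : \bigcup_(i in P) ball (B i).1 (B i).2 = \bigcup_N F N.
  apply/seteqP; split=> [x [i Pi ix]|x [N _ [b /= /FP[i [Pi Bi _]] bx]]].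
    exists (@pickle I i).+1 => //; exists (B i) => //.
    by apply/FP; exists i.
  by exists i => //; rewrite Bi.
have mF N : measurable (F N) by exact: measurable_ball_union.
have cF : mu (F N) @[N --> \oo] --> mu (\bigcup_N F N).
  apply: nondecreasing_cvg_mu => //; first exact: bigcupT_measurable.
  by move=> m N mN; apply/subsetPset; exact: Fsub.
have ckF := cvgeZl (y := k%:E) isT cF.
rewrite -(cvg_lim _ ckF)//; apply: lime_le; first by apply/cvg_ex; eexists; exact: ckF.
apply: nearW => N; apply: le_trans (ball_union_le mh h0 k0 _) _.
  by move=> b /FP[i [Pi <- _]]; exact: hP.
apply: lee_wpmul2l; first by rewrite lee_fin exprn_ge0.
by apply: ge0_subset_integral => //; exact: mF.
Qed.

End covering.

(** * Superlevel sets of the maximal function *)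

Lemma geometric_nneseries {R : realType} (c rho : R) : 0 <= rho -> rho < 1 ->
  (\sum_(0 <= k <oo) (c * rho ^+ k)%:E = (c / (1 - rho))%:E)%E.
Proof.
move=> r0 r1; apply/cvg_lim => //.
under eq_fun do rewrite sumEFin.
apply: cvg_EFin; first exact: nearW.
apply: (@cvg_trans _ (series (geometric c rho) n @[n --> \oo])) => //.
by apply: cvg_geometric_series; rewrite ger0_norm.
Qed.

(** Below the threshold kappa the first term suffices, above it the second does.
    This turns integrability of the q-th power into a weak type estimate without
    truncating the function. *)
Lemma le_addMpowR {R : realType} (u kappa q : R) : 0 <= u -> 0 < kappa -> 1 <= q ->
  u <= kappa + kappa `^ (1 - q) * u `^ q.
Proof.
move=> u0 k0 q1; have [uk|ku] := leP u kappa.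
  by rewrite (le_trans uk)// lerDl mulr_ge0// powR_ge0.
have {}u0 : 0 < u by rewrite (lt_trans k0).
apply: ler_wpDl; first exact: ltW.
have -> : u `^ q = u `^ (q - 1) * u.
  by rewrite -[in LHS](subrK 1 q) [LHS]powRD ?(gt_eqF u0) ?implybT// powRr1 ?ltW.
rewrite mulrA ler_peMl ?(ltW u0)//.
rewrite -(opprB q 1) powRN ler_pdivlMl ?powR_gt0// mulr1.
by apply: ge0_ler_powR; rewrite ?nnegrE ?subr_ge0// ltW.
Qed.

(** The source of the linear growth in the conjugate exponent: with
    e = q - 1 <= 1, the bound 2^e >= 1 + e / 2 follows from 2 >= exp (1 / 2). *)
Lemma inv_one_sub_powR2 {R : realType} (q : R) : 1 < q <= 2 ->
  (1 - 2 `^ (1 - q))^-1 <= 3 / (q - 1).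
Proof.
move=> /andP[q1 q2]; set e := q - 1.
have e0 : 0 < e by rewrite subr_gt0.
have e1 : e <= 1 by rewrite lerBlDr.
have pe : 1 + e / 2 <= 2 `^ e.
  have h2 : expR (2^-1) <= (2 : R).
    have := expR_ge1Dx (- (2^-1) : R); rewrite expRN => h.
    have := expR_gt0 (2^-1 : R); set y := expR _ in h *.
    move=> y0; have : y * (1 - 2^-1) <= 1.
      by rewrite mulrC -ler_pdivlMr// mul1r.
    lra.
  apply: le_trans (ge0_ler_powR (ltW e0) _ _ h2); rewrite ?nnegrE ?expR_ge0//.
  rewrite -expRM; have := expR_ge1Dx (2^-1 * e); lra.
have p0 : 0 < (2 : R) `^ e by rewrite powR_gt0.
rewrite -(opprB q 1) -/e powRN.
have -> : 1 - (2 `^ e)^-1 = (2 `^ e - 1) / 2 `^ e.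
  by rewrite mulrBl divff ?gt_eqF// mul1r.
rewrite invf_div ler_pdivrMr; last by lra.
rewrite mulrAC ler_pdivlMr//.
nra.
Qed.

Section level_sets.
Context {R : realType} {n : nat}.
Local Notation mu := (@lebesgue_rV R n).
Implicit Types (a : 'rV[R]_n -> R) (lam q : R).

(** The set where the uncentred maximal function of a, taken over rational
    balls, exceeds lam. *)
Definition superlevel a lam : set 'rV[R]_n :=
  \bigcup_(i in [set i : 'rV[rat]_n * rat | 0 < (ratr i.2 : R) /\
    (lam%:E * mu (rational_ball i) < \int[mu]_(x in rational_ball i) `|a x|%:E)%E])
  rational_ball i.

Lemma measurable_superlevel a lam : measurable (superlevel a lam).
Proof.
rewrite /superlevel bigcup_mkcond.
apply: countable_bigcupT_measurable => [|i]; first exact: countableP.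
by case: ifPn => // _; exact: measurable_ball_rV.
Qed.

(** On a ball where the mean of |a| exceeds lam, half of this mean is due to
    (lam / 2)^(1-q) |a|^q, because the remaining part of |a| is at most lam / 2. *)
Lemma superlevel_weak_type a lam q :
  measurable_fun [set: 'rV[R]_n] a -> 0 < lam -> 1 <= q ->
  ((lam / 2)%:E * mu (superlevel a lam) <=
   (3 ^+ n * (lam / 2) `^ (1 - q))%:E * \int[mu]_x (`|a x| `^ q)%:E)%E.
Proof.
move=> ma lam0 q1; have k0 : 0 < lam / 2 by rewrite divr_gt0.
have maq : measurable_fun [set: 'rV[R]_n] (fun x => (`|a x| `^ q)%:E).
  apply/measurable_EFinP.
  by apply: (measurableT_comp (measurable_powR q)); exact: measurableT_comp.
have maE : measurable_fun [set: 'rV[R]_n] (fun x => `|a x|%:E).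
  by apply/measurable_EFinP; exact: measurableT_comp.
pose h x := (((lam / 2) `^ (1 - q))%:E * (`|a x| `^ q)%:E)%E.
have h0 x : (0 <= h x)%E by rewrite mule_ge0// lee_fin powR_ge0.
have mh : measurable_fun [set: 'rV[R]_n] h by exact: measurable_funeM.
rewrite [(3 ^+ n * _)%:E]EFinM -muleA -ge0_integralZl//; last first.
  by rewrite lee_fin powR_ge0.
apply: (@bigcup_ball_le _ _ h _ _
  (fun i => (map_mx ratr i.1 : 'rV[R]_n, ratr i.2 : R))) => //=; first exact: ltW.
move=> i /= [i0]; rewrite -/(rational_ball i) => hi; split => //.
have mi : measurable (rational_ball i : set 'rV[R]_n) by exact: measurable_ball_rV.
have vi : mu (rational_ball i) \is a fin_num.
  by rewrite /rational_ball lebesgue_rV_ball.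
have lev : ((lam / 2)%:E * mu (rational_ball i) \is a fin_num)%E by rewrite fin_numM.
rewrite -(@leeD2lE _ ((lam / 2)%:E * mu (rational_ball i))%E)//.
rewrite -ge0_muleDl ?lee_fin ?(ltW k0)// -EFinD -splitr.
apply: le_trans (ltW hi) _.
rewrite -integral_cst// -ge0_integralD//; last 2 first.
- by move=> x _; rewrite /cst lee_fin ltW.
- exact: measurable_funTS.
apply: ge0_le_integral => //.
- exact: measurable_funTS.
- by apply: emeasurable_funD => //; exact: measurable_funTS.
- by move=> x _; rewrite /cst /h -EFinM -EFinD lee_fin le_addMpowR.
Qed.

(** Added to lam, this dominates the maximal function of a: at a point where the
    latter lies between 2^K lam and 2^(K+1) lam, the sum is (2^(K+1) - 1) lam. *)
Definition level_excess a lam (x : 'rV[R]_n) : \bar R :=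
  (\sum_(0 <= k <oo) (2 ^+ k * lam * \1_(superlevel a (2 ^+ k * lam)) x)%:E)%E.

Lemma level_excess_ge0 a lam x : 0 <= lam -> (0 <= level_excess a lam x)%E.
Proof.
by move=> l0; apply: nneseries_ge0 => k _ _; rewrite lee_fin !mulr_ge0// exprn_ge0.
Qed.

Lemma measurable_level_excess a lam : 0 <= lam ->
  measurable_fun [set: 'rV[R]_n] (level_excess a lam).
Proof.
move=> l0; apply: ge0_emeasurable_sum.
  by move=> k x _ _; rewrite lee_fin !mulr_ge0// exprn_ge0.
move=> k _; apply/measurable_EFinP; apply: measurable_funM => //.
by apply: measurable_indic; exact: measurable_superlevel.
Qed.

Lemma integral_level_excess_le a lam q : measurable_fun [set: 'rV[R]_n] a ->
  0 < lam -> 1 < q <= 2 ->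
  (\int[mu]_x level_excess a lam x <=
   (12 * 3 ^+ n / (q - 1) * lam `^ (1 - q))%:E * \int[mu]_x (`|a x| `^ q)%:E)%E.
Proof.
move=> ma lam0 q12; have /andP[q1 q2] := q12.
have lk k : 0 < 2 ^+ k * lam by rewrite mulr_gt0// exprn_gt0.
set M := (\int[mu]_x (`|a x| `^ q)%:E)%E.
have M0 : (0 <= M)%E by apply: integral_ge0 => x _; rewrite lee_fin powR_ge0.
rewrite integral_nneseries//; last 2 first.
- move=> k; apply/measurable_EFinP; apply: measurable_funM => //.
  by apply: measurable_indic; exact: measurable_superlevel.
- by move=> k x _; rewrite lee_fin !mulr_ge0// ltW// lk.
have c0 : 0 < 12 * 3 ^+ n / (q - 1) * lam `^ (1 - q).
  by rewrite mulr_gt0 ?powR_gt0// divr_gt0 ?subr_gt0// mulr_gt0 ?exprn_gt0.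
have [Moo|/lt_eqF/negbT Moo] := leP +oo%E M.
  by move: Moo; rewrite leye_eq => /eqP ->; rewrite gt0_muley ?lte_fin// leey.
have Mfin : M \is a fin_num by rewrite ge0_fin_numE// ltey.
rewrite -(fineK Mfin) in M0 *; set m := fine M in M0 *.
have term k : (\int[mu]_x (2 ^+ k * lam * \1_(superlevel a (2 ^+ k * lam)) x)%:E <=
    (2 * 3 ^+ n * (lam / 2) `^ (1 - q) * m * (2 `^ (1 - q)) ^+ k)%:E)%E.
  under eq_integral do rewrite EFinM.
  rewrite ge0_integralZl_EFin//; last 2 first.
  - by apply/measurable_EFinP/measurable_indic; exact: measurable_superlevel.
  - exact: ltW.
  rewrite integral_indic ?setIT//; last exact: measurable_superlevel.
  have := superlevel_weak_type ma (lk k) (ltW q1); rewrite -/M -(fineK Mfin) -/m => h.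
  rewrite [X in (X * _)%E](_ : _ = (2%:E * (2 ^+ k * lam / 2)%:E)%E); last first.
    by rewrite -EFinM; congr EFin; lra.
  rewrite -muleA; apply: le_trans (lee_wpmul2l _ h) _; first by rewrite lee_fin.
  rewrite -!EFinM lee_fin.
  have -> : 2 ^+ k * lam / 2 = 2 ^+ k * (lam / 2) by rewrite mulrA.
  rewrite powRM ?exprn_ge0 ?divr_ge0 ?(ltW lam0)//.
  by rewrite -!powR_mulrn ?powR_ge0// powRAC; lra.
apply: (@le_trans _ _ (\sum_(0 <= k <oo)
    (2 * 3 ^+ n * (lam / 2) `^ (1 - q) * m * (2 `^ (1 - q)) ^+ k)%:E)%E).
  apply: lee_nneseries => [k _ _|k _]; last exact: term.
  by apply: integral_ge0 => x _; rewrite lee_fin mulr_ge0// (ltW (lk k)).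
have rho1 : (2 : R) `^ (1 - q) < 1.
  rewrite -(opprB q 1) powRN invf_lt1 ?powR_gt0//.
  have q10 : 0 < q - 1 by rewrite subr_gt0.
  have := @gt0_ltr_powR R (q - 1) q10 1 2.
  by rewrite powR1 /=; apply; rewrite ?nnegrE// ltr1n.
rewrite geometric_nneseries ?powR_ge0// -EFinM lee_fin.
have half : (lam / 2) `^ (1 - q) <= 2 * lam `^ (1 - q).
  rewrite powRM ?(ltW lam0)// mulrC ler_wpM2r ?powR_ge0//.
  rewrite -powR_inv1// -powRrM mulN1r opprB.
  by apply: ler1_powR; rewrite ?ler1n// lerBlDr.
have := inv_one_sub_powR2 q12; have : 0 <= (1 - 2 `^ (1 - q))^-1.
  by rewrite invr_ge0 subr_ge0 ltW.
set D := _^-1; set F := (q - 1)^-1 => D0 DF.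
rewrite (_ : _ * D = (2 * 3 ^+ n * m) *
  ((lam / 2) `^ (1 - q) * D)); last by lra.
rewrite [leRHS](_ : _ = (2 * 3 ^+ n * m) * (2 * lam `^ (1 - q) * (3 * F))); last by lra.
apply: ler_wpM2l; first by rewrite mulr_ge0// mulr_ge0// exprn_ge0.
by apply: ler_pM => //; exact: powR_ge0.
Qed.

(** The ball is included in a rational ball of radius less than 3 r, whose
    volume is at most (6 r)^n and over which the mean A of |a| is compared with
    the levels 2^k lam. *)
Lemma ball_integral_le a lam x r : mu.-integrable [set: 'rV[R]_n] (EFin \o a) ->
  0 < lam -> 0 < r ->
  (\int[mu]_(y in ball x r) `|a y|%:E <=
   ((r *+ 6) ^+ n)%:E * (lam%:E + level_excess a lam x))%E.
Proof.
move=> ia lam0 r0.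
have [i [xi i0 i3]] := rational_ball_sandwich x r0.
have ma : measurable_fun [set: 'rV[R]_n] a.
  by apply/measurable_EFinP; exact: measurable_int ia.
have maE : measurable_fun [set: 'rV[R]_n] (fun x => `|a x|%:E).
  by apply/measurable_EFinP; exact: measurableT_comp.
have mi : measurable (rational_ball i : set 'rV[R]_n) by exact: measurable_ball_rV.
have mx : measurable (ball x r) by exact: measurable_ball_rV.
have Ifin : (\int[mu]_(y in rational_ball i) `|a y|%:E)%E \is a fin_num.
  rewrite ge0_fin_numE; last exact: integral_ge0.
  have /integrableP[_] := ia; apply: le_lt_trans.
  by apply: ge0_subset_integral.
have vE : mu (rational_ball i) = ((ratr i.2 *+ 2) ^+ n)%:E by exact: lebesgue_rV_ball.
set v := (ratr i.2 *+ 2) ^+ n in vE.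
have v0 : 0 < v by rewrite exprn_gt0// mulrn_wgt0.
set I := fine (\int[mu]_(y in rational_ball i) `|a y|%:E)%E.
have IE : (\int[mu]_(y in rational_ball i) `|a y|%:E = I%:E)%E by rewrite fineK.
pose A := I / v.
(* As long as A exceeds 2^K lam, the point x lies in the K-th level set and
   the partial sum doubles along with the cap 2^K lam. *)
have low K : ((Num.min A (2 ^+ K * lam))%:E <= lam%:E +
    \sum_(0 <= k < K) (2 ^+ k * lam * \1_(superlevel a (2 ^+ k * lam)) x)%:E)%E.
  elim: K => [|K IH].
    by rewrite big_nil adde0 expr0 mul1r lee_fin ge_min lexx orbT.
  rewrite big_nat_recr//= addeA.
  have [AK|KA] := leP A (2 ^+ K * lam).
    rewrite (min_idPl AK) in IH; apply: (@le_trans _ _ A%:E).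
      by rewrite lee_fin ge_min lexx.
    apply: (le_trans IH); rewrite leeDl// lee_fin !mulr_ge0// ?exprn_ge0//.
    exact: ltW.
  rewrite (min_idPr (ltW KA)) in IH.
  have xK : x \in superlevel a (2 ^+ K * lam).
    rewrite inE; exists i; last by apply: xi; exact: ballxx.
    by split => //=; rewrite vE IE -EFinM lte_fin -ltr_pdivlMr.
  rewrite indicE xK mulr1.
  apply: (@le_trans _ _ ((2 ^+ K * lam)%:E + (2 ^+ K * lam)%:E)%E); last exact: leeD.
  by rewrite -EFinD lee_fin ge_min exprS; apply/orP; right; lra.
have AH : (A%:E <= lam%:E + level_excess a lam x)%E.
  have [K AK] : exists K : nat, A <= 2 ^+ K * lam.
    exists (Num.truncn (A / lam)).+1; rewrite -ler_pdivrMr//.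
    have := truncnS_gt (A / lam); move/ltW/le_trans; apply.
    by rewrite -natrX ler_nat ltnW// ltn_expl.
  have := low K; rewrite (min_idPl AK) => /le_trans; apply.
  apply: leeD => //; apply: nneseries_lim_ge => k _ _.
  by rewrite lee_fin !mulr_ge0// ?exprn_ge0// (ltW lam0).
apply: (@le_trans _ _ I%:E).
  by rewrite -IE; apply: ge0_subset_integral => //; exact: measurable_funTS.
have -> : I%:E = (v%:E * A%:E)%E by rewrite -EFinM /A mulrC divfK// gt_eqF.
apply: lee_pmul => //.
- by rewrite lee_fin ltW.
- rewrite lee_fin divr_ge0 ?(ltW v0)// fine_ge0//; exact: integral_ge0.
- rewrite lee_fin /v; apply: lerXn2r; rewrite ?nnegrE; lra.
Qed.

End level_sets.

(** * Schwartz kernels *)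

Lemma mean_value_abs {R : realType} (g dg : R -> R) (h : R) :
  (forall x, is_derive x (1 : R) g (dg x)) ->
  exists2 c, `|c| <= `|h| & g h - g 0 = dg c * h.
Proof.
move=> gdg.
have cg (a b : R) : {within `[a, b], continuous g}.
  apply: derivable_within_continuous => x _; exact: ex_derive.
have [h0|h0] := leP 0 h.
  have [c] := @MVT_segment R g dg 0 h h0 (fun x _ => gdg x) (cg 0 h).
  rewrite in_itv/= subr0 => /andP[c0 ch] ->; exists c => //.
  by rewrite !ger0_norm.
have [c] := @MVT_segment R g dg h 0 (ltW h0) (fun x _ => gdg x) (cg h 0).
rewrite in_itv/= sub0r => /andP[hc c0] E; exists c.
  by rewrite !ler0_norm ?lerN2// ltW.
by rewrite -opprB E mulrN opprK.
Qed.

Lemma dyadic_scale {R : realType} (r : R) : 1 <= r ->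
  exists j, 2 ^+ j <= r < 2 ^+ j.+1.
Proof.
move=> r1; have ex : exists j, r < 2 ^+ j.
  exists (Num.truncn r).+1; apply: lt_trans (truncnS_gt r) _.
  by rewrite -natrX ltr_nat ltn_expl.
case: (ex_minnP ex) => -[|j] rj jmin; first by move: rj; rewrite expr0 ltNge r1.
exists j; rewrite rj andbT leNgt; apply/negP => /jmin.
by rewrite ltnn.
Qed.

Section kernel.
Context {R : realType} {n : nat}.
Local Notation mu := (@lebesgue_rV R n).
Implicit Types (Phi a : 'rV[R]_n -> R) (u v w x y z : 'rV[R]_n) (C l t : R).

Lemma is_derive_coord_line Phi (i : 'I_n) w :
  (forall x, derivable Phi x (delta_mx ord0 i)) ->
  forall s : R, is_derive s (1 : R) (fun s : R => Phi (s *: delta_mx ord0 i + w))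
    (partial i Phi (s *: delta_mx ord0 i + w)).
Proof.
move=> dPhi s.
have E : (fun h : R => h^-1 *: (((fun s : R => Phi (s *: delta_mx ord0 i + w)) \o
    shift s) (h *: (1 : R)) - Phi (s *: delta_mx ord0 i + w))) =
  (fun h : R => h^-1 *: ((Phi \o shift (s *: delta_mx ord0 i + w))
    (h *: delta_mx ord0 i) - Phi (s *: delta_mx ord0 i + w))).
  by apply/funext => h /=; rewrite [h *: 1]mulr1 scalerDl addrA.
apply: DeriveDef; first by rewrite /derivable E; exact: dPhi.
by rewrite /partial /derive E.
Qed.

Lemma delta_rowE (i j : 'I_n) (k : 'I_1) :
  (delta_mx ord0 i : 'rV[R]_n) k j = (j == i)%:R.
Proof. by rewrite mxE (ord1 k) eqxx. Qed.

(** The mean value theorem is applied along one coordinate at a time, on the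
    path from v to u through the points whose first k coordinates are those of
    u. In the sup norm this path stays in the ball of radius |u - v| about v. *)
Lemma partial_diff_le Phi (M : R) u v :
  (forall i x, derivable Phi x (delta_mx ord0 i)) ->
  (forall i w, `|w - v| <= `|u - v| -> `|partial i Phi w| <= M) ->
  `|Phi u - Phi v| <= n%:R * (M * `|u - v|).
Proof.
move=> dPhi PhiM.
pose w_ k : 'rV[R]_n := \row_i (if (i < k)%N then u ord0 i else v ord0 i).
have wn : w_ n = u by apply/rowP => i; rewrite mxE ltn_ord.
have w0 : w_ 0%N = v by apply/rowP => i; rewrite mxE.
rewrite -{1}wn -{1}w0 -(telescope_sumr (fun k => Phi (w_ k)))// big_mkord.
apply: le_trans (ler_norm_sum _ _ _) _.
have -> : n%:R * (M * `|u - v|) = \sum_(k < n) (M * `|u - v|).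
  by rewrite sumr_const card_ord mulr_natl.
apply: ler_sum => k _.
have [c ck] := mean_value_abs (u ord0 k - v ord0 k) (is_derive_coord_line (w_ k) (dPhi k)).
have -> : (u ord0 k - v ord0 k) *: delta_mx ord0 k + w_ k = w_ k.+1.
  apply/rowP => i; rewrite !(delta_rowE, mxE) ltnS [(i <= k)%N]leq_eqVlt.
  have [->|ik] := eqVneq i k; first by rewrite eqxx ltnn mulr1 subrK.
  by rewrite (negbTE (_ : (i : nat) != k))// mulr0 add0r.
rewrite scale0r add0r => ->; rewrite normrM ler_pM//; last first.
  by apply: le_trans (coord_le_norm _ k); rewrite !mxE.
apply: PhiM; apply: norm_rV_le => // i.
have := coord_le_norm (u - v) i; rewrite !(delta_rowE, mxE).
have [->|ik] := eqVneq i k; last by case: ifPn => _; rewrite mulr0 add0r// subrr normr0.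
by rewrite ltnn mulr1 addrK => _; apply: (le_trans ck);
  apply: le_trans (coord_le_norm _ k); rewrite !mxE.
Qed.

(** The power n + 1 is the least integer power whose decay is integrable at
    infinity. *)
Definition decaying C Phi :=
  forall u, `|Phi u| <= C /\ `|u| ^+ n.+1 * `|Phi u| <= C.

Lemma schwartz_decaying Phi : schwartz Phi -> exists C,
  [/\ 0 < C, decaying C Phi & forall i, decaying C (partial i Phi)].
Proof.
move=> sPhi.
have dec (b : seq 'I_n) : exists2 C, 0 <= C & decaying C (foldr partial Phi b).
  have [_ bPhi] := sPhi b; have [C0 hC0] := bPhi 0%N; have [C1 hC1] := bPhi n.+1.
  exists (`|C0| + `|C1|) => [|u]; first by rewrite addr_ge0.
  split; [apply: (@le_trans _ _ C0)|apply: (@le_trans _ _ C1)].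
  - by have := hC0 u; rewrite expr0 mul1r.
  - by rewrite (le_trans (ler_norm _))// lerDl.
  - exact: hC1.
  - by rewrite (le_trans (ler_norm _))// lerDr.
have [C C0 PhiC] := dec [::].
have /choice[D hD] (i : 'I_n) : exists D, 0 <= D /\ decaying D (partial i Phi).
  by have [D D0 PhiD] := dec [:: i]; exists D.
have sD0 : 0 <= \sum_i D i by apply: sumr_ge0 => i _; have [] := hD i.
exists (1 + C + \sum_i D i); split=> [|u|i u].
- by rewrite -addrA ltr_pwDl// addr_ge0.
- by have [h1 h2] := PhiC u; split; [apply: (le_trans h1)|apply: (le_trans h2)]; lra.
- have DD : D i <= \sum_i D i.
    by rewrite (bigD1 i)//= lerDl sumr_ge0// => j _; have [] := hD j.
  have [_ /(_ u)[h1 h2]] := hD i.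
  by split; [apply: (le_trans h1)|apply: (le_trans h2)]; lra.
Qed.

Lemma decaying_continuous C Phi :
  (forall i x, derivable Phi x (delta_mx ord0 i)) ->
  (forall i, decaying C (partial i Phi)) -> continuous Phi.
Proof.
move=> dPhi dC x.
have lip y : `|Phi y - Phi x| <= n%:R * (C * `|y - x|).
  by apply: partial_diff_le => // i w _; have [] := dC i w.
apply/(@cvgrPdist_le _ _ _ (nbhs x) (nbhs_filter x)) => /= e e0.
have C0 : 0 <= `|C| by [].
have d0 : 0 < n%:R * `|C| + 1 by rewrite ltr_wpDl// mulr_ge0.
near=> y.
rewrite distrC; apply: (le_trans (lip y)).
apply: (@le_trans _ _ ((n%:R * `|C| + 1) * `|y - x|)).
  rewrite mulrA ler_wpM2r//; apply: (@le_trans _ _ (n%:R * `|C|)).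
    by rewrite ler_wpM2l// ler_norm.
  by rewrite lerDl.
rewrite mulrC -ler_pdivlMr// ltW// distrC.
by near: y; apply: cvgr_dist_lt => //; rewrite divr_gt0.
Unshelve. all: by end_near. Qed.

End kernel.

(** * Convolution with a dilated kernel near the support *)

Section convolution.
Context {R : realType} {n : nat}.
Local Notation mu := (@lebesgue_rV R n).
Implicit Types (Phi a : 'rV[R]_n -> R) (u v w x y z : 'rV[R]_n) (C l t : R).

Definition dilate Phi t x y := t ^- n * Phi (t^-1 *: (x - y)).

Lemma measurable_dilate Phi t x : measurable_fun [set: 'rV[R]_n] Phi ->
  measurable_fun [set: 'rV[R]_n] (dilate Phi t x).
Proof.
move=> mPhi; apply: measurable_funM => //; apply: (measurableT_comp mPhi).
apply: measurable_fun_rVP => i; under eq_fun do rewrite !mxE.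
apply: measurable_funM => //; apply: measurable_funB => //.
exact: measurable_coord.
Qed.

Lemma integrable_dilateM Phi C a x t : measurable_fun [set: 'rV[R]_n] Phi ->
  (forall u, `|Phi u| <= C) -> 0 < t -> mu.-integrable [set: 'rV[R]_n] (EFin \o a) ->
  mu.-integrable [set: 'rV[R]_n] (fun y => (dilate Phi t x y * a y)%:E).
Proof.
move=> mPhi PhiC t0 ia; have C0 : 0 <= C := le_trans (normr_ge0 _) (PhiC 0).
have ma : measurable_fun [set: 'rV[R]_n] a.
  by apply/measurable_EFinP; exact: measurable_int ia.
have mk := measurable_dilate t x mPhi.
apply: (@le_integrable _ _ _ _ _ _ _ (fun y => (t ^- n * C)%:E * (a y)%:E)%E) => //.
- by apply/measurable_EFinP; exact: measurable_funM.
- move=> y _; rewrite -EFinM !abse_EFin lee_fin !normrM ler_wpM2r//.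
  by rewrite ler_wpM2l// (ger0_norm C0).
- exact: integrableZl.
Qed.

(** The kernel is a superposition of multiples of indicator functions of balls,
    so that its convolution with a is controlled by means of |a| over balls. *)
Lemma decaying_dyadic C Phi u : decaying C Phi -> 0 <= C ->
  (`|Phi u|%:E <= \sum_(0 <= j <oo)
    (2 ^+ n.+1 * C * (2 ^- n.+1) ^+ j * (`|u| < 2 ^+ j)%R%:R)%:E)%E.
Proof.
move=> dPhi C0; have [h1 h2] := dPhi u.
have [u1|u1] := ltP `|u| 1.
  apply: le_trans (nneseries_lim_ge 1%N _); last first.
    by move=> j _ _; rewrite lee_fin !mulr_ge0// ?exprn_ge0// invr_ge0 exprn_ge0.
  rewrite big_nat1 lee_fin !expr0 u1 !mulr1; apply: (le_trans h1).
  by rewrite ler_peMl// exprn_ege1// ler1n.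
have [j /andP[ju uj]] := dyadic_scale u1.
apply: le_trans (nneseries_lim_ge j.+2 _); last first.
  by move=> i _ _; rewrite lee_fin !mulr_ge0// ?exprn_ge0// invr_ge0 exprn_ge0.
rewrite big_nat_recr//= uj mulr1.
apply: (@le_trans _ _ (2 ^+ n.+1 * C * 2 ^- n.+1 ^+ j.+1)%:E); last first.
  rewrite leeDr//; apply: sume_ge0 => i _.
  by rewrite lee_fin !mulr_ge0// ?exprn_ge0// invr_ge0 exprn_ge0.
have p0 : 0 < 2 ^+ n.+1 :> R by rewrite exprn_gt0.
rewrite lee_fin [_ ^+ j.+1]exprS mulrACA [_ * (_ ^- _)]mulfV ?gt_eqF// mul1r.
rewrite exprVn ler_pdivlMr ?exprn_gt0//; apply: le_trans h2; rewrite mulrC.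
rewrite ler_wpM2r// -exprM mulnC exprM.
by apply: lerXn2r; rewrite ?nnegrE ?exprn_ge0.
Qed.

Lemma ball_dilate x y t j : 0 < t ->
  (`|t^-1 *: (x - y)| < 2 ^+ j)%R%:R = \1_(ball x (2 ^+ j * t)) y :> R.
Proof.
move=> t0; rewrite indicE normrZ gtr0_norm ?invr_gt0// mulrC ltr_pdivrMr//.
by congr ((nat_of_bool _)%:R); apply/idP/idP; rewrite inE -ball_normE.
Qed.

(** Over the ball of radius 2^j t the kernel has size t^(-n) 2^(-j(n+1)) and the
    integral of |a| is at most (6 2^j t)^n H: the scale j contributes O(2^(-j) H),
    uniformly in t. *)
Lemma dilate_conv_le C Phi a x t (H : \bar R) : decaying C Phi -> 0 < C ->
  measurable_fun [set: 'rV[R]_n] Phi -> measurable_fun [set: 'rV[R]_n] a ->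
  0 < t -> (0 <= H)%E ->
  (forall r : R, (0 < r)%R ->
    \int[mu]_(y in ball x r) `|a y|%:E <= ((r *+ 6) ^+ n)%:E * H)%E ->
  (`|\int[mu]_y (dilate Phi t x y * a y)%:E| <=
    (C * 2 ^+ n.+2 * 6 ^+ n)%:E * H)%E.
Proof.
move=> dPhi C0 mPhi ma t0 H0 aH.
have maE : measurable_fun [set: 'rV[R]_n] (fun x => `|a x|%:E).
  by apply/measurable_EFinP; exact: measurableT_comp.
have mk := measurable_dilate t x mPhi.
have [Hoo|Hlt] := leP +oo%E H.
  move: Hoo; rewrite leye_eq => /eqP ->; rewrite gt0_muley ?leey//.
  by rewrite lte_fin; apply: mulr_gt0; [apply: mulr_gt0|]; rewrite ?exprn_gt0.
have Hfin : H \is a fin_num by rewrite ge0_fin_numE.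
apply: le_trans (le_abse_integral _ _ _) _ => //.
  by apply/measurable_EFinP; exact: measurable_funM.
pose c j := t ^- n * (2 ^+ n.+1 * C * (2 ^- n.+1) ^+ j).
have c0 j : 0 <= c j.
  by rewrite !mulr_ge0// ?invr_ge0 ?exprn_ge0// ?invr_ge0 ?exprn_ge0// ltW.
pose g j y := ((c j)%:E * (`|a y|%:E * (\1_(ball x (2 ^+ j * t)) y)%:E))%E.
have mb j : measurable (ball x (2 ^+ j * t)) by exact: measurable_ball_rV.
have mg j : measurable_fun [set: 'rV[R]_n] (g j).
  apply: measurable_funeM; apply: emeasurable_funM => //.
  by apply/measurable_EFinP; exact: measurable_indic.
have g0 j y : (0 <= g j y)%E by rewrite !mule_ge0// lee_fin.
apply: (@le_trans _ _ (\int[mu]_y \sum_(0 <= j <oo) g j y)%E).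
  apply: ge0_le_integral => //.
  - by apply: measurableT_comp => //; apply/measurable_EFinP; exact: measurable_funM.
  - exact: ge0_emeasurable_sum.
  move=> y _; rewrite abse_EFin normrM EFinM /dilate normrM ger0_norm; last first.
    by rewrite invr_ge0 exprn_ge0// ltW.
  have -> : (\sum_(0 <= j <oo) g j y = (t ^- n * `|a y|)%:E * \sum_(0 <= j <oo)
      (2 ^+ n.+1 * C * (2 ^- n.+1) ^+ j *
       (`|t^-1 *: (x - y)| < 2 ^+ j)%R%:R)%:E)%E.
    rewrite -nneseriesZl => [|j _].
      apply: eq_eseriesr => j _; rewrite /g /c ball_dilate// -!EFinM.
      by congr EFin; lra.
    by rewrite lee_fin !mulr_ge0// ?exprn_ge0// ?(ltW C0)// invr_ge0 exprn_ge0.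
  rewrite -!EFinM mulrAC EFinM lee_wpmul2l//; last exact: decaying_dyadic (ltW C0).
  by rewrite lee_fin mulr_ge0// invr_ge0 exprn_ge0// ltW.
rewrite integral_nneseries//.
apply: (@le_trans _ _ (\sum_(0 <= j <oo) (C * 2 ^+ n.+1 * 6 ^+ n * fine H * 2^-1 ^+ j)%:E)%E).
  apply: lee_nneseries => [j _ _|j _]; first exact: integral_ge0.
  rewrite /g ge0_integralZl_EFin//; last first.
    apply: emeasurable_funM => //.
    by apply/measurable_EFinP; exact: measurable_indic.
  have -> : (\int[mu]_y (`|a y|%:E * (\1_(ball x (2 ^+ j * t)) y)%:E) =
      \int[mu]_(y in ball x (2 ^+ j * t)) `|a y|%:E)%E.
    by rewrite [RHS]integral_mkcond epatch_indic.
  have jt : 0 < 2 ^+ j * t by rewrite mulr_gt0// exprn_gt0.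
  apply: le_trans (lee_wpmul2l _ (aH _ jt)) _; first by rewrite lee_fin.
  rewrite -(fineK Hfin) -!EFinM lee_fin /= /c.
  have -> : (2 ^+ j * t *+ 6) ^+ n = (2 ^+ j) ^+ n * t ^+ n * 6 ^+ n.
    by rewrite -mulr_natr !exprMn.
  have e2 : (2 ^- n.+1) ^+ j * (2 ^+ j) ^+ n = 2^-1 ^+ j :> R.
    rewrite -exprVn -!exprM mulSn exprD mulrC mulrCA mulnC -exprMn.
    by rewrite mulfV// expr1n mulr1.
  rewrite -e2.
  have tn : t ^- n * t ^+ n = 1 by rewrite mulVf// expf_eq0 gt_eqF// andbF.
  rewrite [leRHS](_ : _ = (t ^- n * t ^+ n) * (C * 2 ^+ n.+1 * 6 ^+ n * fine H *
    (2 ^- n.+1 ^+ j * 2 ^+ j ^+ n))); last by rewrite tn mul1r.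
  by rewrite le_eqVlt; apply/orP; left; apply/eqP; lra.
rewrite (geometric_nneseries (C * 2 ^+ n.+1 * 6 ^+ n * fine H)) ?invr_ge0// ?invf_lt1// ?ltr1n//.
rewrite -[in leRHS](fineK Hfin) -EFinM lee_fin [2 ^+ n.+2]exprS.
have -> : 1 - 2^-1 = 2^-1 :> R by lra.
by rewrite invrK; lra.
Qed.
End convolution.

(** * Cancellation far from the support *)

Section far.
Context {R : realType} {n : nat}.
Local Notation mu := (@lebesgue_rV R n).
Implicit Types (Phi a : 'rV[R]_n -> R) (u v w x y z : 'rV[R]_n) (C l t : R).

(** Between (x - y) / t and (x - z) / t all points have norm at least
    |x - z| / (2 t), so the gradient is of order (t / |x - z|)^(n+1) there; the
    powers of t cancel. *)
Lemma dilate_diff_le C Phi x y z l t :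
  (forall i x, derivable Phi x (delta_mx ord0 i)) ->
  (forall i, decaying C (partial i Phi)) -> 0 <= C -> 0 < l -> 0 < t ->
  `|y - z| <= l -> l *+ 2 <= `|x - z| ->
  `|dilate Phi t x y - dilate Phi t x z| <=
    n%:R * 2 ^+ n.+1 * C * (l / `|x - z| ^+ n.+1).
Proof.
move=> dPhi dC C0 l0 t0 yz xz.
rewrite /dilate -mulrBr normrM ger0_norm ?invr_ge0 ?exprn_ge0 ?(ltW t0)//.
set u := t^-1 *: (x - y); set v := t^-1 *: (x - z).
have tV0 : 0 < t^-1 by rewrite invr_gt0.
have uv : `|u - v| = t^-1 * `|y - z|.
  rewrite -scalerBr normrZ gtr0_norm// distrC; congr (_ * `|_|).
  by rewrite opprB addrC addrA subrK.
have vE : `|v| = t^-1 * `|x - z| by rewrite normrZ gtr0_norm.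
have v0 : 0 < `|v| by rewrite vE mulr_gt0//; lra.
have half : `|u - v| <= `|v| / 2.
  by rewrite uv vE -mulrA ler_pM2l//; lra.
have bound i w : `|w - v| <= `|u - v| -> `|partial i Phi w| <= C / (`|v| / 2) ^+ n.+1.
  move=> wv; have [_ dw] := dC i w.
  have vw : `|v| / 2 <= `|w|.
    have : `|v| <= `|w - v| + `|w|.
      by rewrite -[X in `|X| <= _](subKr w) [leRHS]addrC ler_normB.
    lra.
  rewrite ler_pdivlMr ?exprn_gt0 ?divr_gt0//; apply: le_trans dw.
  rewrite mulrC ler_wpM2r//; apply: lerXn2r => //; rewrite nnegrE; lra.
apply: le_trans (ler_wpM2l _ (partial_diff_le dPhi bound)) _.
  by rewrite invr_ge0 exprn_ge0// ltW.
rewrite uv vE.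
have xz0 : 0 < `|x - z| by lra.
have -> : C / (t^-1 * `|x - z| / 2) ^+ n.+1 =
    C * (t ^+ n.+1 * 2 ^+ n.+1 / `|x - z| ^+ n.+1).
  by rewrite !exprMn !exprVn !invfM !invrK; congr (C * _); rewrite mulrAC.
have tn : t ^- n * t ^+ n.+1 * t^-1 = 1.
  rewrite exprSr mulrA mulVf ?expf_neq0 ?gt_eqF// mul1r mulfV// gt_eqF//.
set V := _ ^- n.+1.
have V0 : 0 <= V by rewrite invr_ge0 exprn_ge0.
rewrite [leLHS](_ : _ = (t ^- n * t ^+ n.+1 * t^-1) *
  (n%:R * 2 ^+ n.+1 * C * (`|y - z| * V))); last by lra.
rewrite tn mul1r ler_wpM2l//; last by rewrite ler_wpM2r.
by rewrite mulr_ge0// mulr_ge0// exprn_ge0.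
Qed.

(** As a has integral zero, the kernel may be replaced by its difference with
    its value at y = z. *)
Lemma dilate_conv_far_le C Phi a x z l t :
  (forall i x, derivable Phi x (delta_mx ord0 i)) ->
  decaying C Phi -> (forall i, decaying C (partial i Phi)) ->
  0 <= C -> 0 < l -> 0 < t ->
  mu.-integrable [set: 'rV[R]_n] (EFin \o a) ->
  (\int[mu]_y (a y)%:E = 0)%E -> (forall y, a y != 0 -> `|y - z| <= l) ->
  l *+ 2 <= `|x - z| ->
  (`|\int[mu]_y (dilate Phi t x y * a y)%:E| <=
   (n%:R * 2 ^+ n.+1 * C * (l / `|x - z| ^+ n.+1))%:E * \int[mu]_y `|a y|%:E)%E.
Proof.
move=> dPhi PhiC dC C0 l0 t0 ia a0 supp xz.
have ma : measurable_fun [set: 'rV[R]_n] a.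
  by apply/measurable_EFinP; exact: measurable_int ia.
have mPhi : measurable_fun [set: 'rV[R]_n] Phi.
  exact: continuous_measurable_rV (decaying_continuous dPhi dC).
have mk := measurable_dilate t x mPhi.
have ik : mu.-integrable [set: 'rV[R]_n] (fun y => (dilate Phi t x y * a y)%:E).
  by apply: integrable_dilateM ia => // u; exact: (PhiC u).1.
have ikz : mu.-integrable [set: 'rV[R]_n] (fun y => (dilate Phi t x z)%:E * (a y)%:E)%E.
  exact: integrableZl.
have -> : (\int[mu]_y (dilate Phi t x y * a y)%:E =
    \int[mu]_y ((dilate Phi t x y - dilate Phi t x z) * a y)%:E)%E.
  under [RHS]eq_integral do rewrite mulrBl EFinB (EFinM (dilate _ _ _ z)).
  by rewrite integralB// integralZl// a0 mule0 sube0.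
apply: le_trans (le_abse_integral _ _ _) _ => //.
  by apply/measurable_EFinP; apply: measurable_funM => //; exact: measurable_funB.
rewrite -ge0_integralZl_EFin//; last 2 first.
- by apply/measurable_EFinP; exact: measurableT_comp.
- by rewrite !mulr_ge0// ?exprn_ge0// ?(ltW l0)// invr_ge0 exprn_ge0.
apply: ge0_le_integral => //.
- apply: measurableT_comp => //; apply/measurable_EFinP.
  by apply: measurable_funM => //; exact: measurable_funB.
- by apply: measurable_funeM; apply/measurable_EFinP; exact: measurableT_comp.
move=> y _; rewrite -EFinM abse_EFin lee_fin normrM.
have [->|ay] := eqVneq (a y) 0; first by rewrite normr0 !mulr0.
by rewrite ler_wpM2r// dilate_diff_le// supp.
Qed.

(** A majorant of l / |x - z|^(n+1) away from z which is a series of multiples of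
    indicator functions of balls, so that its integral is a geometric series. *)
Definition dyadic_tail z l x : \bar R :=
  (\sum_(0 <= j <oo)
    (2^-1 ^+ j * (2 ^+ j * l) ^- n * \1_(ball z (2 ^+ j.+1 * l)) x)%:E)%E.

Let tail_term_ge0 z l j x : 0 < l ->
  (0 <= (2^-1 ^+ j * (2 ^+ j * l) ^- n * \1_(ball z (2 ^+ j.+1 * l)) x)%:E)%E.
Proof.
move=> l0; rewrite lee_fin mulr_ge0// mulr_ge0// ?exprn_ge0 ?invr_ge0//.
by rewrite exprn_ge0// mulr_ge0 ?exprn_ge0// ltW.
Qed.

Lemma dyadic_tail_ge0 z l x : 0 < l -> (0 <= dyadic_tail z l x)%E.
Proof. by move=> l0; apply: nneseries_ge0 => j _ _; exact: tail_term_ge0. Qed.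

Let measurable_tail_term z l j : measurable_fun [set: 'rV[R]_n]
  (fun x => (2^-1 ^+ j * (2 ^+ j * l) ^- n * \1_(ball z (2 ^+ j.+1 * l)) x)%:E).
Proof.
apply/measurable_EFinP; apply: measurable_funM => //.
by apply: measurable_indic; exact: measurable_ball_rV.
Qed.

Lemma measurable_dyadic_tail z l : 0 < l -> measurable_fun [set: 'rV[R]_n] (dyadic_tail z l).
Proof. by move=> l0; apply: ge0_emeasurable_sum => // j x _ _; exact: tail_term_ge0. Qed.

Lemma integral_dyadic_tail z l : 0 < l -> (\int[mu]_x dyadic_tail z l x = (2 * 4 ^+ n)%:E)%E.
Proof.
move=> l0; rewrite integral_nneseries//; last by move=> j x _; exact: tail_term_ge0.
rewrite (_ : 2 * _ = 4 ^+ n / (1 - 2^-1)); last first.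
  by have -> : 1 - 2^-1 = 2^-1 :> R; [lra | rewrite invrK mulrC].
rewrite -geometric_nneseries ?invr_ge0// ?invf_lt1// ?ltr1n//.
apply: eq_eseriesr => j _.
have l2 k : 0 < 2 ^+ k * l by rewrite mulr_gt0// exprn_gt0.
have mb : measurable (ball z (2 ^+ j.+1 * l)) by exact: measurable_ball_rV.
under eq_integral do rewrite EFinM.
rewrite ge0_integralZl_EFin//; last 2 first.
- by apply/measurable_EFinP/measurable_indic.
- by rewrite mulr_ge0// ?exprn_ge0 ?invr_ge0// exprn_ge0// (ltW (l2 j)).
rewrite integral_indic// setIT.
rewrite [X in (_ * X)%E](lebesgue_rV_ball _ (l2 _)) -EFinM; congr EFin.
have -> : 2 ^+ j.+1 * l *+ 2 = 4 * (2 ^+ j * l) by rewrite exprS; lra.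
by rewrite [(4 * _) ^+ n]exprMn mulrCA divfK// expf_neq0// gt_eqF.
Qed.

Lemma le_dyadic_tail x z l : 0 < l -> l <= `|x - z| ->
  ((l / `|x - z| ^+ n.+1)%:E <= dyadic_tail z l x)%E.
Proof.
move=> l0 lx; have [j /andP[]] : exists j, 2 ^+ j <= `|x - z| / l < 2 ^+ j.+1.
  by apply: dyadic_scale; rewrite ler_pdivlMr// mul1r.
rewrite ler_pdivlMr// ltr_pdivrMr// => jx xj.
apply: le_trans (nneseries_lim_ge j.+1 _); last by move=> i _ _; exact: tail_term_ge0.
rewrite big_nat_recr//=.
apply: (@le_trans _ _ (2^-1 ^+ j * (2 ^+ j * l) ^- n * \1_(ball z (2 ^+ j.+1 * l)) x)%:E).
  rewrite indicE mem_set ?mulr1; last by rewrite -ball_normE /ball_/= distrC.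
  have jl : 0 < 2 ^+ j * l by rewrite mulr_gt0// exprn_gt0.
  have -> : 2^-1 ^+ j * (2 ^+ j * l) ^- n = l / (2 ^+ j * l) ^+ n.+1.
    by rewrite exprS invfM exprVn invfM [RHS]mulrA [in RHS]mulrCA mulfV ?gt_eqF// mulr1.
  rewrite lee_fin ler_wpM2l ?(ltW l0)// lef_pV2 ?posrE ?exprn_gt0//; last by lra.
  by apply: lerXn2r; rewrite ?nnegrE// ltW.
by rewrite leeDr//; apply: sume_ge0 => i _; exact: tail_term_ge0.
Qed.

End far.

(** * Atoms *)

Section atoms.
Context {R : realType} {n : nat}.
Local Notation mu := (@lebesgue_rV R n).
Implicit Types (Phi a : 'rV[R]_n -> R) (x y z : 'rV[R]_n) (Q : set 'rV[R]_n).
Implicit Types (l lam p q s : R).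

Lemma conjugate_exponent_bounds p q : 1 < q <= 2 -> p^-1 + q^-1 = 1 ->
  2 <= p /\ (q - 1)^-1 <= p.
Proof.
move=> /andP[q1 q2] pq; have q0 : 0 < q by lra.
have pE : p^-1 = (q - 1) / q by rewrite mulrBl divff ?gt_eqF//; lra.
have p0 : 0 < p by rewrite -invr_gt0 pE divr_gt0// subr_gt0.
split.
  rewrite -lef_pV2 ?posrE// pE ler_pdivrMr//; lra.
rewrite -[leRHS]invrK lef_pV2 ?posrE ?invr_gt0// ?subr_gt0// pE.
by rewrite ler_pdivrMr// ler_peMr// ?ltW// subr_gt0.
Qed.

Lemma measurable_cube z l : measurable (cube z l).
Proof.
have -> : cube z l = \bigcap_(i in [set: 'I_n])
    ((fun y : 'rV[R]_n => y ord0 i) @^-1` `[z ord0 i, z ord0 i + l]%classic).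
  apply/seteqP; split=> [y Ay i _|y Ay i] /=.
    by rewrite in_itv/=; exact: Ay.
  by have := Ay i I; rewrite /= in_itv.
apply: fin_bigcap_measurable => // i _; rewrite -[_ @^-1` _]setTI.
by apply: measurable_coord => //; exact: measurable_itv.
Qed.

Lemma lebesgue_cube z l : 0 < l -> mu (cube z l) = (l ^+ n)%:E.
Proof.
move=> l0.
rewrite (_ : cube z l = [set x | forall i, `[z ord0 i, z ord0 i + l]%classic (x ord0 i)]).
  rewrite (lebesgue_rV_box (A := fun i => `[z ord0 i, z ord0 i + l]%classic)) => [|i].
    under eq_bigr => i _.
      rewrite lebesgue_measure_itv/= lte_fin ltrDl l0 -EFinB addrAC subrr add0r.
      over.
    by rewrite prodEFin prodr_const card_ord.
  exact: measurable_itv.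
by apply/seteqP; split=> y Ay i; have := Ay i; rewrite /= in_itv.
Qed.

Lemma integral_supportE (f : 'rV[R]_n -> \bar R) Q :
  (forall x, ~ Q x -> f x = 0%E) -> (\int[mu]_(x in Q) f x = \int[mu]_x f x)%E.
Proof.
move=> fQ; rewrite integral_mkcond; apply: eq_integral => x _.
by rewrite patchE; case: ifPn => // /negP; rewrite inE => /fQ.
Qed.

(** The size condition of an atom says that the mean of |a|^q over its cube is
    at most lam^q, where lam is p^(-1/s) divided by the volume of the cube. The
    L^1 bound comes from |a| <= lam + lam^(1-q) |a|^q rather than from the Hoelder
    inequality, at the cost of a factor 2. *)
Lemma atomP p q s Q a : 1 < q <= 2 -> p^-1 + q^-1 = 1 -> is_cube Q ->
  atom p q s Q a -> exists z l lam,
  [/\ 0 < l, 0 < lam, lam * l ^+ n = (p `^ s^-1)^-1,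
      measurable_fun [set: 'rV[R]_n] a /\ (forall y, a y != 0 -> `|y - z| <= l) &
      [/\ (\int[mu]_x (`|a x| `^ q)%:E <= (lam `^ q * l ^+ n)%:E)%E,
        (\int[mu]_x `|a x|%:E <= (2 * (lam * l ^+ n))%:E)%E &
        (\int[mu]_x (a x)%:E = 0)%E]].
Proof.
move=> q12 pq [z [l [l0 ->{Q}]]] [ma supp a0 an].
have [p2 _] := conjugate_exponent_bounds q12 pq; have /andP[q1 q2] := q12.
have q0 : 0 < q by lra.
have p0 : 0 < p by lra.
have sub y : ~ cube z l y -> a y = 0.
  by move=> Qy; apply/eqP; apply: contra_notT Qy => ay; apply/supp/subset_closure.
have P0 : 0 < p `^ s^-1 by rewrite powR_gt0.
have V0 : 0 < l ^+ n by rewrite exprn_gt0.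
pose lam := (p `^ s^-1 * l ^+ n)^-1.
have lam0 : 0 < lam by rewrite invr_gt0 mulr_gt0.
have lamV : lam * l ^+ n = (p `^ s^-1)^-1.
  by rewrite /lam invfM -mulrA mulVf ?mulr1// gt_eqF.
have mQ := measurable_cube z l.
have muQ := lebesgue_cube z l0.
have aqQ : (\int[mu]_(x in cube z l) (`|a x| `^ q)%:E = \int[mu]_x (`|a x| `^ q)%:E)%E.
  by apply: integral_supportE => x /sub ->; rewrite normr0 powR0// gt_eqF.
have aq : (\int[mu]_x (`|a x| `^ q)%:E <= (lam `^ q * l ^+ n)%:E)%E.
  move: an; rewrite aqQ muQ inver gt_eqF//=.
  have : (0 <= \int[mu]_x (`|a x| `^ q)%:E)%E.
    by apply: integral_ge0 => x _; rewrite lee_fin powR_ge0.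
  case: (\int[mu]_x _)%E => [i| |]//; rewrite ?lee_fin.
    move=> i0 h.
    have {}h : (l ^- n * i) `^ q^-1 <= lam.
      by rewrite /lam -[leRHS]mul1r ler_pdivlMr ?mulr_gt0// mulrC.
    have := @ge0_ler_powR R q (ltW q0) ((l ^- n * i) `^ q^-1) lam.
    rewrite !nnegrE powR_ge0 (ltW lam0) => /(_ isT isT h).
    rewrite -powRrM mulVf ?gt_eqF// powRr1; last first.
      by rewrite mulr_ge0// invr_ge0 ltW.
    by rewrite ler_pdivrMl// mulrC.
  (* an infinite integral would make the normalised mean infinite *)
  move=> _; rewrite gt0_muley ?lte_fin ?invr_gt0// poweRyr; last first.
    by rewrite gt_eqF// invr_gt0.
  by rewrite gt0_muley// -EFinM lte_fin mulr_gt0.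
exists z, l, lam; split => //.
  split => // y ay; apply: norm_rV_le => [|i]; first exact: ltW.
  have /supp/(_ i) : closure [set x | a x != 0] y by exact: subset_closure.
  rewrite !mxE => /andP[h1 h2].
  by rewrite ger0_norm ?subr_ge0// lerBlDl.
have maq : measurable_fun [set: 'rV[R]_n] (fun x => (`|a x| `^ q)%:E).
  apply/measurable_EFinP.
  by apply: (measurableT_comp (measurable_powR q)); exact: measurableT_comp.
split => //; last by rewrite -a0 [RHS]integral_supportE// => x /sub ->.
rewrite -(@integral_supportE _ (cube z l)); last by move=> x /sub ->; rewrite normr0.
apply: (@le_trans _ _ (\int[mu]_(x in cube z l)
    (lam%:E + (lam `^ (1 - q))%:E * (`|a x| `^ q)%:E)%E)%E).
  apply: ge0_le_integral => //.
  - by apply/measurable_EFinP; apply: measurable_funTS; exact: measurableT_comp.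
  - apply: emeasurable_funD => //.
    by apply: measurable_funeM; exact: measurable_funTS.
  - move=> x _; rewrite -EFinM -EFinD lee_fin.
    by apply: le_addMpowR => //; exact: ltW.
rewrite ge0_integralD//; last 3 first.
- by move=> x _; rewrite lee_fin ltW.
- by move=> x _; rewrite -EFinM lee_fin mulr_ge0// powR_ge0.
- by apply: measurable_funeM; exact: measurable_funTS.
rewrite integral_cst// [X in (lam%:E * X)%E]muQ ge0_integralZl_EFin//; last 2 first.
- exact: measurable_funTS.
- exact: powR_ge0.
rewrite aqQ; apply: (@le_trans _ _ ((lam * l ^+ n)%:E +
    (lam `^ (1 - q))%:E * (lam `^ q * l ^+ n)%:E)%E).
  by rewrite -EFinM leeD2l// lee_wpmul2l// lee_fin powR_ge0.
rewrite -EFinM -EFinD lee_fin [lam `^ (1 - q) * _]mulrA -powRD ?(gt_eqF lam0)// ?implybT//.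
by rewrite subrK powRr1 ?(ltW lam0)//; lra.
Qed.

End atoms.

(** * The maximal function of an atom *)

Section atom_maximal.
Context {R : realType} {n : nat}.
Local Notation mu := (@lebesgue_rV R n).
Implicit Types (Phi a : 'rV[R]_n -> R) (x y z : 'rV[R]_n) (Q : set 'rV[R]_n).
Implicit Types (l lam p q s : R).

Lemma integral_powR_excess a lam q p (V : R) : measurable_fun [set: 'rV[R]_n] a ->
  0 < lam -> 0 <= V -> 1 < q <= 2 -> (q - 1)^-1 <= p ->
  (\int[mu]_x (`|a x| `^ q)%:E <= (lam `^ q * V)%:E)%E ->
  (\int[mu]_x level_excess a lam x <= (12 * 3 ^+ n * p * (lam * V))%:E)%E.
Proof.
move=> ma lam0 V0 q12 qp aq.
have q10 : 0 < q - 1 by move: q12 => /andP[]; rewrite subr_gt0.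
apply: le_trans (integral_level_excess_le ma lam0 q12) _.
have c0 : 0 <= 12 * 3 ^+ n / (q - 1) * lam `^ (1 - q).
  by rewrite mulr_ge0 ?powR_ge0// mulr_ge0 ?invr_ge0 ?(ltW q10)// mulr_ge0// exprn_ge0.
apply: le_trans (lee_wpmul2l _ aq) _; first by rewrite lee_fin.
have lamE : lam `^ (1 - q) * lam `^ q = lam.
  by rewrite -powRD ?(gt_eqF lam0)// ?implybT// subrK powRr1 ?(ltW lam0).
rewrite -EFinM lee_fin [leLHS]mulrA -(mulrA _ _ (lam `^ q)) lamE -(mulrA _ lam).
apply: ler_wpM2r; first by rewrite mulr_ge0// ltW.
by apply: ler_wpM2l => //; rewrite mulr_ge0// exprn_ge0.
Qed.

(** The majorant G is the sum of the near bound D (lam + excess), where the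
    constant lam is kept only on the ball B of radius 2 l about the corner z of
    the cube, and of the far bound, which is used outside B. All contributions
    to its integral are multiples of lam |Q| = p^(-1/s), and only the excess
    over lam brings a factor p. *)
Lemma atom_maximal_le Phi : schwartz Phi -> exists2 K, 0 < K &
  forall s p q Q a, 1 < q <= 2 -> p^-1 + q^-1 = 1 -> is_cube Q -> atom p q s Q a ->
  exists G : 'rV[R]_n -> \bar R,
  [/\ measurable_fun [set: 'rV[R]_n] G, (forall x, 0 <= G x)%E,
      (forall x, maximal_fun Phi a x <= G x)%E &
      (\int[mu]_x G x <= (K * (p * (p `^ s^-1)^-1))%:E)%E].
Proof.
move=> sPhi; have [C [C0 PhiC dC]] := schwartz_decaying sPhi.
have dPhi i x : derivable Phi x (delta_mx ord0 i) by exact: (sPhi [::]).1.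
have mPhi : measurable_fun [set: 'rV[R]_n] Phi.
  exact: continuous_measurable_rV (decaying_continuous dPhi dC).
pose D := C * 2 ^+ n.+2 * 6 ^+ n.
pose E := n%:R * 2 ^+ n.+1 * C.
have D0 : 0 < D by apply: mulr_gt0; [apply: mulr_gt0|]; rewrite ?exprn_gt0.
have E0 : 0 <= E by apply: mulr_ge0; [apply: mulr_ge0|]; rewrite ?exprn_ge0// ltW.
exists (D * (4 ^+ n + 12 * 3 ^+ n) + E * (4 * 4 ^+ n)).
  rewrite ltr_pwDl//.
    exact: mulr_gt0.
  exact: mulr_ge0.
move=> s p q Q a q12 pq cQ aQ.
have [z [l [lam [l0 lam0 lamV [ma supp] [aq a1 a0]]]]] := atomP q12 pq cQ aQ.
have [p2 qp] := conjugate_exponent_bounds q12 pq.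
have p0 : 0 <= p by lra.
rewrite -lamV.
have V0 : 0 < l ^+ n by rewrite exprn_gt0.
set m := lam * l ^+ n in a1 *.
have m0 : 0 < m by rewrite mulr_gt0.
have ia : mu.-integrable [set: 'rV[R]_n] (EFin \o a).
  apply/integrableP; split; first exact/measurable_EFinP.
  by apply: le_lt_trans a1 _; rewrite ltry.
pose B := ball z (l *+ 2).
have mB : measurable B by exact: measurable_ball_rV.
pose near x := (D%:E * ((lam * \1_B x)%:E + level_excess a lam x))%E.
pose far x := ((E * (2 * m))%:E * dyadic_tail z l x)%E.
have b0 x : (0 <= (lam * \1_B x)%:E)%E by rewrite lee_fin mulr_ge0// ltW.
have mb : measurable_fun [set: 'rV[R]_n] (fun x => (lam * \1_B x)%:E).
  by apply/measurable_EFinP; apply: measurable_funM => //; exact: measurable_indic.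
have ex0 x : (0 <= level_excess a lam x)%E by apply: level_excess_ge0; exact: ltW.
have mex : measurable_fun [set: 'rV[R]_n] (level_excess a lam).
  by apply: measurable_level_excess; exact: ltW.
have near0 x : (0 <= near x)%E by rewrite mule_ge0 ?lee_fin ?(ltW D0)// adde_ge0.
have far0 x : (0 <= far x)%E.
  by rewrite mule_ge0 ?dyadic_tail_ge0// lee_fin !mulr_ge0// ltW.
have mnear : measurable_fun [set: 'rV[R]_n] near.
  by apply: measurable_funeM; exact: emeasurable_funD.
have mfar : measurable_fun [set: 'rV[R]_n] far.
  by apply: measurable_funeM; exact: measurable_dyadic_tail.
exists (fun x => near x + far x)%E; split.
- exact: emeasurable_funD.
- by move=> x; rewrite adde_ge0.
- move=> x; apply: ub_ereal_sup => _ [t /= t0 <-].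
  have [xz|xz] := ltP `|x - z| (l *+ 2).
    apply: (@le_trans _ _ (near x)); last by rewrite leeDl.
    rewrite /near indicE mem_set ?mulr1; last by rewrite /B -ball_normE /ball_/= distrC.
    apply: dilate_conv_le => // [|r r0]; first by rewrite adde_ge0// lee_fin ltW.
    exact: ball_integral_le.
  apply: (@le_trans _ _ (far x)); last by rewrite leeDr.
  apply: le_trans (dilate_conv_far_le dPhi PhiC dC (ltW C0) l0 t0 ia a0 supp xz) _.
  rewrite -/E /far [(E * (l / _))%:E]EFinM [(E * (2 * m))%:E]EFinM -!muleA.
  apply: lee_wpmul2l; first by rewrite lee_fin.
  rewrite muleC; apply: lee_pmul => //; first exact: integral_ge0.
    by rewrite lee_fin mulr_ge0 ?(ltW l0)// invr_ge0 exprn_ge0.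
  by apply: le_dyadic_tail => //; lra.
rewrite ge0_integralD// ge0_integralZl_EFin//; last 3 first.
- by move=> x _; rewrite adde_ge0.
- exact: emeasurable_funD.
- exact: ltW.
rewrite ge0_integralZl_EFin//; last 3 first.
- by move=> x _; exact: dyadic_tail_ge0.
- exact: measurable_dyadic_tail.
- by rewrite !mulr_ge0// ltW.
rewrite integral_dyadic_tail// ge0_integralD//.
under eq_integral do rewrite EFinM.
rewrite ge0_integralZl_EFin//; last 2 first.
- by apply/measurable_EFinP; exact: measurable_indic.
- exact: ltW.
rewrite integral_indic// setIT [X in (lam%:E * X)%E](lebesgue_rV_ball _ _); last first.
  by rewrite mulrn_wgt0.
have hex := integral_powR_excess ma lam0 (ltW V0) q12 qp aq.
apply: (@le_trans _ _ (D%:E * (lam%:E * ((l *+ 2 *+ 2) ^+ n)%:E +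
   (12 * 3 ^+ n * p * m)%:E) + (E * (2 * m))%:E * (2 * 4 ^+ n)%:E)%E).
  by rewrite leeD2r// lee_wpmul2l ?lee_fin ?(ltW D0)// leeD2l.
rewrite -[(lam%:E * _)%E]EFinM -[X in (D%:E * X)%E]EFinD -!EFinM -EFinD lee_fin.
have -> : (l *+ 2 *+ 2) ^+ n = 4 ^+ n * l ^+ n.
  by rewrite -exprMn; congr (_ ^+ _); lra.
have -> : lam * (4 ^+ n * l ^+ n) = 4 ^+ n * m by rewrite /m; lra.
have p1 : 1 <= p by lra.
have h4 : D * 4 ^+ n * m <= D * 4 ^+ n * m * p.
  by rewrite ler_peMr// mulr_ge0 ?(ltW m0)// mulr_ge0 ?(ltW D0).
have h5 : E * 4 ^+ n * m <= E * 4 ^+ n * m * p.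
  by rewrite ler_peMr// mulr_ge0 ?(ltW m0)// mulr_ge0.
lra.
Qed.

End atom_maximal.

(** * Series and the maximal function *)

Lemma le_cvg0D {R : realType} (X S : \bar R) (e : nat -> \bar R) :
  e @ \oo --> 0%E -> (forall N, (X <= e N + S)%E) -> (X <= S)%E.
Proof.
move=> e0 XeS.
have eS : (e N + S)%E @[N --> \oo] --> S.
  rewrite -[X in _ --> X]add0e; apply: cvgeD => //; last exact: cvg_cst.
rewrite -(cvg_lim _ eS)//; apply: lime_ge; last exact: nearW.
by apply/cvg_ex; exists S.
Qed.

(** The integral of a nonnegative function is a supremum over the simple
    functions below it, so that it is monotone whether or not the functions are
    measurable. *)
Lemma lower_integral_le d (T : measurableType d) (R : realType)
    (nu : {measure set T -> \bar R}) (f g : T -> \bar R) :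
  (forall x, 0 <= f x)%E -> (forall x, f x <= g x)%E ->
  (\int[nu]_x f x <= \int[nu]_x g x)%E.
Proof.
move=> f0 fg; have g0 x : (0 <= g x)%E by exact: le_trans (fg x).
rewrite !ge0_integralTE//; apply: ereal_sup_le => _ [h /= hf <-].
exists h => //= x.
exact: le_trans (hf x) (fg x).
Qed.

Section series.
Context d (T : measurableType d) (R : realType) (mu : {measure set T -> \bar R}).
Implicit Types (b : nat -> T -> R).

(** The sum is defined pointwise where the series converges absolutely, and as 0
    on the remaining null set; dominated convergence gives the limit in L^1. *)
Lemma l1_series b : (forall j, measurable_fun [set: T] (b j)) ->
  (\sum_(0 <= j <oo) \int[mu]_x `|b j x|%:E < +oo)%E ->
  exists f, mu.-integrable [set: T] (EFin \o f) /\
    (\int[mu]_x `|f x - \sum_(j < N) b j x|%:E)%E @[N --> \oo] --> 0%E.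
Proof.
move=> mb bfin.
have mbE j : measurable_fun [set: T] (fun x => `|b j x|%:E).
  by apply/measurable_EFinP; exact: measurableT_comp.
pose g x : \bar R := (\sum_(0 <= j <oo) `|b j x|%:E)%E.
have g0 x : (0 <= g x)%E by apply: nneseries_ge0.
have mg : measurable_fun [set: T] g by exact: ge0_emeasurable_sum.
have ig : mu.-integrable [set: T] g.
  apply/integrableP; split => //.
  under eq_integral do rewrite gee0_abs//.
  by rewrite integral_nneseries.
pose D := [set x | g x \is a fin_num].
have mD : measurable D.
  by have := emeasurable_fin_num measurableT mg; rewrite setTI.
pose S N x := \sum_(j < N) b j x.
have mS N : measurable_fun [set: T] (S N) by exact: measurable_sum.
have cS x : D x -> cvgn (S ^~ x).
  move=> Dx; rewrite (_ : S ^~ x = series (fun j => b j x)); last first.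
    by apply/funext => N; rewrite /S /series /= big_mkord.
  apply: normed_cvg; apply: nnseries_is_cvg => [j|] /=; first exact: normr_ge0.
  by move: Dx; rewrite /D /= ge0_fin_numE.
pose f x : R := limn (fun N => S N x * \1_D x).
have Sf : forall x, (S N x * \1_D x) @[N --> \oo] --> f x.
  move=> x; have [Dx|Dx] := pselect (D x).
    rewrite /f indicE mem_set//; under eq_fun do rewrite mulr1.
    exact: cS.
  rewrite /f indicE memNset//; under eq_fun do rewrite mulr0.
  by rewrite lim_cst//; exact: cvg_cst.
have mf : measurable_fun [set: T] f.
  apply: (@measurable_fun_cvg _ _ _ _ (fun N x => S N x * \1_D x)) => // N.
  by apply: measurable_funM => //; exact: measurable_indic.
have aeD : {ae mu, forall x, [set: T] x -> D x} by exact: integrable_ae.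
have mSE N : measurable_fun [set: T] (EFin \o S N) by exact/measurable_EFinP.
have mfE : measurable_fun [set: T] (EFin \o f) by exact/measurable_EFinP.
have aeS : {ae mu, forall x, [set: T] x -> (EFin \o S N) x @[N --> \oo] --> (EFin \o f) x}.
  apply: filterS aeD => x /(_ I) Dx _.
  apply: cvg_EFin; first exact: nearW.
  have := Sf x; rewrite indicE mem_set//; under eq_fun do rewrite mulr1.
  exact.
have aeg : {ae mu, forall x N, [set: T] x -> (`|(EFin \o S N) x| <= g x)%E}.
  apply: aeW => x N _; rewrite /=.
  apply: (@le_trans _ _ (\sum_(0 <= j < N) `|b j x|%:E)%E).
    by rewrite sumEFin lee_fin big_mkord ler_norm_sum.
  exact: nneseries_lim_ge.
have [h1 h2 _] := dominated_convergence measurableT mSE mfE aeS ig aeg.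
exists f; split => //.
apply: cvg_trans h2; apply: near_eq_cvg; apply: nearW => N /=.
by apply: eq_integral => x _; rewrite /S /= distrC.
Qed.

End series.

Section maximal.
Context {R : realType} {n : nat}.
Local Notation mu := (@lebesgue_rV R n).
Implicit Types (Phi a f : 'rV[R]_n -> R).

Lemma maximal_fun_ge0 Phi f x : (0 <= maximal_fun Phi f x)%E.
Proof.
apply: (@le_trans _ _ `|\int[mu]_y (1 ^- n * Phi (1^-1 *: (x - y)) * f y)%:E|%E) => //.
by apply: ereal_sup_ubound; exists 1 => //=.
Qed.

Lemma maximal_funZ_le Phi (c : R) f x : (forall t, 0 < t ->
    mu.-integrable [set: 'rV[R]_n] (fun y => (dilate Phi t x y * f y)%:E)) ->
  (maximal_fun Phi (fun y => (c * f y)%R) x <= `|c|%:E * maximal_fun Phi f x)%E.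
Proof.
move=> idf; apply: ub_ereal_sup => _ [t /= t0 <-].
under eq_integral do rewrite mulrCA EFinM.
rewrite integralZl//; last exact: idf.
rewrite abseM; apply: lee_wpmul2l => //.
by apply: ereal_sup_ubound; exists t.
Qed.

(** For a fixed dilation the kernel is bounded, so that convergence in L^1 passes
    to the convolutions and the triangle inequality applies to the series. *)
Lemma maximal_fun_series Phi (C : R) f (b : nat -> 'rV[R]_n -> R)
    (G : nat -> 'rV[R]_n -> \bar R) :
  measurable_fun [set: 'rV[R]_n] Phi -> (forall u, `|Phi u| <= C) ->
  mu.-integrable [set: 'rV[R]_n] (EFin \o f) ->
  (forall j, mu.-integrable [set: 'rV[R]_n] (EFin \o b j)) ->
  (\int[mu]_x `|f x - \sum_(j < N) b j x|%:E)%E @[N --> \oo] --> 0%E ->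
  (forall j x, maximal_fun Phi (b j) x <= G j x)%E ->
  forall x, (maximal_fun Phi f x <= \sum_(0 <= j <oo) G j x)%E.
Proof.
move=> mPhi PhiC iF ib fb bG x.
apply: ub_ereal_sup => _ [t /= t0 <-].
have C0 : 0 <= C := le_trans (normr_ge0 _) (PhiC 0).
have mk := measurable_dilate t x mPhi.
pose F g := `|\int[mu]_y (dilate Phi t x y * g y)%:E|%E.
have FD g h : mu.-integrable [set: 'rV[R]_n] (EFin \o g) ->
    mu.-integrable [set: 'rV[R]_n] (EFin \o h) ->
    (F (fun y => (g y + h y)%R) <= F g + F h)%E.
  move=> ig ih; rewrite /F; under eq_integral do rewrite mulrDr EFinD.
  rewrite integralD//; first exact: lee_abs_add.
  - exact: integrable_dilateM ig.
  - exact: integrable_dilateM ih.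
pose S N y := \sum_(j < N) b j y.
have iS N : mu.-integrable [set: 'rV[R]_n] (EFin \o S N).
  rewrite (_ : _ \o _ = fun y => \sum_(j < N) (b j y)%:E)%E; last first.
    by apply/funext => y /=; rewrite sumEFin.
  by apply: (@integrable_sum _ _ _ mu _ measurableT _ (index_enum 'I_N) xpredT
    (fun j y => (b j y)%:E)) => j _; exact: ib.
have FS N : (F (S N) <= \sum_(0 <= j < N) F (b j))%E.
  elim: N => [|N IH].
    rewrite big_nil /F; under eq_integral do rewrite /S big_ord0 mulr0.
    by rewrite integral0 abse0.
  rewrite big_nat_recr//= (_ : S N.+1 = fun y => S N y + b N y); last first.
    by apply/funext => y; rewrite /S big_ord_recr.
  by apply: le_trans (FD _ _ (iS N) (ib N)) _; exact: leeD2r.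
have FL g : measurable_fun [set: 'rV[R]_n] g ->
    (F g <= (t ^- n * C)%:E * \int[mu]_y `|g y|%:E)%E.
  move=> mg; apply: le_trans (le_abse_integral _ _ _) _ => //.
    by apply/measurable_EFinP; exact: measurable_funM.
  have tC : 0 <= t ^- n * C by rewrite mulr_ge0// invr_ge0 exprn_ge0// ltW.
  have mgE : measurable_fun [set: 'rV[R]_n] (fun y => `|g y|%:E).
    by apply/measurable_EFinP; exact: measurableT_comp.
  rewrite -ge0_integralZl_EFin//; apply: ge0_le_integral => //.
  - apply: measurableT_comp => //; apply/measurable_EFinP.
    exact: measurable_funM.
  - exact: measurable_funeM.
  move=> y _; rewrite -EFinM abse_EFin lee_fin !normrM ler_wpM2r//.
  by rewrite ger0_norm ?invr_ge0 ?exprn_ge0 ?(ltW t0)// ler_wpM2l// invr_ge0 exprn_ge0// ltW.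
pose e N := ((t ^- n * C)%:E * \int[mu]_y `|f y - S N y|%:E)%E.
apply: (@le_cvg0D _ _ _ e) => [|N].
  by rewrite -(mule0 (t ^- n * C)%:E); exact: cvgeZl.
have iFS : mu.-integrable [set: 'rV[R]_n] (EFin \o (fun y => f y - S N y)).
  rewrite (_ : _ \o _ = fun y => (f y)%:E - (S N y)%:E)%E; last first.
    by apply/funext => y /=; rewrite EFinB.
  exact: integrableB iF (iS N).
rewrite -/(F f) (_ : f = fun y => (f y - S N y) + S N y); last first.
  by apply/funext => y; rewrite subrK.
apply: le_trans (FD _ _ iFS (iS N)) _; apply: leeD.
  by apply: FL; apply/measurable_EFinP; exact: measurable_int iFS.
apply: (le_trans (FS N)); apply: (@le_trans _ _ (\sum_(0 <= j < N) G j x)%E).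
  apply: lee_sum => j _; apply: le_trans (bG j x).
  by apply: ereal_sup_ubound; exists t.
apply: nneseries_lim_ge => j _ _; apply: le_trans (bG j x).
exact: maximal_fun_ge0.
Qed.

End maximal.

(** * Splitting an atomic decomposition *)

Section exponents.
Context {R : realType}.
Implicit Types p t s : R.

Lemma small_exponent_le s (s' : R) p t : 1 < s -> s^-1 + s'^-1 = 1 -> 1 <= p -> p <= t ->
  p * (p `^ s^-1)^-1 <= Num.min t (t `^ s'^-1).
Proof.
move=> s1 ss' p1 pt; have p0 : 0 < p by lra.
have sV : s^-1 < 1 by rewrite invf_lt1// (lt_trans _ s1).
have P1 : 1 <= p `^ s^-1.
  by rewrite -(powRr0 p) ler_powR// invr_ge0; lra.
rewrite le_min; apply/andP; split.
  apply: le_trans pt; rewrite ler_pdivrMr ?(lt_le_trans _ P1)//.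
  by rewrite ler_peMr// ltW.
rewrite -powRN -{1}(powRr1 (ltW p0)) -powRD ?(gt_eqF p0) ?implybT//.
rewrite (_ : 1 + _ = s'^-1); last by lra.
by apply: ge0_ler_powR; rewrite ?nnegrE; lra.
Qed.

Lemma large_exponent_le s (s' : R) p t : 1 < s -> s^-1 + s'^-1 = 1 -> 1 <= p ->
  0 < t -> t <= p -> t * (p `^ s^-1)^-1 <= Num.min t (t `^ s'^-1).
Proof.
move=> s1 ss' p1 t0 tp; have p0 : 0 < p by lra.
have s0 : 0 <= s^-1 by rewrite invr_ge0; lra.
have P1 : 1 <= p `^ s^-1 by rewrite -(powRr0 p) ler_powR.
rewrite le_min; apply/andP; split.
  by rewrite ler_pdivrMr ?(lt_le_trans _ P1)// ler_peMr// ltW.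
apply: (@le_trans _ _ (t * (t `^ s^-1)^-1)).
  rewrite ler_wpM2l ?(ltW t0)// lef_pV2 ?posrE ?powR_gt0//.
  by apply: ge0_ler_powR; rewrite ?nnegrE ?(ltW t0) ?(ltW p0).
rewrite -powRN -{1}(powRr1 (ltW t0)) -powRD ?(gt_eqF t0) ?implybT//.
by rewrite (_ : 1 + _ = s'^-1)//; lra.
Qed.

End exponents.

Section interpolation.
Context {R : realType} {n : nat}.
Local Notation mu := (@lebesgue_rV R n).

(** The H^1 part f1 is the sum of the terms with p <= t, and the L^1 part is
    f - f1. Both f and f1 are limits in L^1 of partial sums, whose difference
    contains only terms with p > t, so that f - f1 has the expected norm. *)
Lemma K_functional_atomic_le (Phi : 'rV[R]_n -> R) (s s' : R) :
  schwartz Phi -> 1 < s -> s^-1 + s'^-1 = 1 ->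
  exists2 c : R, 0 < c & forall f lam (a : nat -> 'rV[R]_n -> R) t,
    L1 f -> 0 < t -> atomic_dec s f lam a ->
    (K_functional Phi t f <=
      (c * Num.min t (t `^ s'^-1))%:E * \sum_(0 <= j <oo) `|lam j|%:E)%E.
Proof.
move=> sPhi s1 ss'.
have [K K0 atomK] := atom_maximal_le sPhi.
have [C [C0 PhiC dC]] := schwartz_decaying sPhi.
have PhiC' u : `|Phi u| <= C by have [] := PhiC u.
have dPhi i x : derivable Phi x (delta_mx ord0 i) by exact: (sPhi [::]).1.
have mPhi : measurable_fun [set: 'rV[R]_n] Phi.
  exact: continuous_measurable_rV (decaying_continuous dPhi dC).
exists (K + 2); first by lra.
move=> f lam a t Lf t0 [atom_a lamfin cvf].
set m := Num.min t (t `^ s'^-1).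
have m0 : 0 <= m by rewrite le_min (ltW t0) powR_ge0.
set L := (\sum_(0 <= j <oo) _)%E in lamfin *.
have /choice[p /choice[G hG]] (j : nat) : exists p : R, exists G : 'rV[R]_n -> \bar R,
    [/\ 1 <= p, measurable_fun [set: 'rV[R]_n] (a j),
      (\int[mu]_x `|a j x|%:E <= (2 * (p `^ s^-1)^-1)%:E)%E &
      [/\ measurable_fun [set: 'rV[R]_n] G, (forall x, 0 <= G x)%E,
       (forall x, maximal_fun Phi (a j) x <= G x)%E &
       (\int[mu]_x G x <= (K * (p * (p `^ s^-1)^-1))%:E)%E]].
  have [p [q [Q [q12 pq cQ aQ]]]] := atom_a j.
  have [G hG] := atomK _ _ _ _ _ q12 pq cQ aQ.
  have [z [l [v [_ _ vE [ma _] [_ a1 _]]]]] := atomP q12 pq cQ aQ.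
  have [p2 _] := conjugate_exponent_bounds q12 pq.
  exists p, G; split => //; first by lra.
  by rewrite -vE.
have p1 j : 1 <= p j by have [] := hG j.
have P0 j : 0 <= (p j `^ s^-1)^-1 by rewrite invr_ge0 powR_ge0.
have P1 j : (p j `^ s^-1)^-1 <= 1.
  rewrite invf_le1 ?powR_gt0 ?(lt_le_trans _ (p1 j))//.
  by rewrite -(powRr0 (p j)) ler_powR// invr_ge0; lra.
have ma j : measurable_fun [set: 'rV[R]_n] (a j) by have [] := hG j.
have a1 j : (\int[mu]_x `|a j x|%:E <= (2 * (p j `^ s^-1)^-1)%:E)%E by have [] := hG j.
have mG j : measurable_fun [set: 'rV[R]_n] (G j) by have [_ _ _ []] := hG j.
have G0 j x : (0 <= G j x)%E by have [_ _ _ []] := hG j.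
have aG j x : (maximal_fun Phi (a j) x <= G j x)%E by have [_ _ _ []] := hG j.
have iG j : (\int[mu]_x G j x <= (K * (p j * (p j `^ s^-1)^-1))%:E)%E.
  by have [_ _ _ []] := hG j.
have maE j : measurable_fun [set: 'rV[R]_n] (fun x => `|a j x|%:E).
  by apply/measurable_EFinP; exact: measurableT_comp.
have ia j : mu.-integrable [set: 'rV[R]_n] (EFin \o a j).
  apply/integrableP; split; first exact/measurable_EFinP.
  by apply: le_lt_trans (a1 j) _; rewrite ltry.
(* coefficients of the atoms that go to H^1 and to L^1, respectively *)
pose lo j := if p j <= t then lam j else 0.
pose hi j := if p j <= t then 0 else lam j.
have lohi j : lam j = lo j + hi j by rewrite /lo /hi; case: ifP; rewrite ?addr0 ?add0r.
pose b j x := lo j * a j x.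
have mb j : measurable_fun [set: 'rV[R]_n] (b j) by exact: measurable_funM.
have ib j : mu.-integrable [set: 'rV[R]_n] (EFin \o b j).
  rewrite (_ : _ \o _ = fun x => (lo j)%:E * (a j x)%:E)%E; last first.
    by apply/funext => x /=; rewrite /b EFinM.
  by apply: integrableZl => //; exact: ia.
have L0 : (0 <= L)%E by apply: nneseries_ge0.
have Lfin : L \is a fin_num by rewrite ge0_fin_numE.
have int_scale c j : (\int[mu]_x `|c * a j x|%:E = `|c|%:E * \int[mu]_x `|a j x|%:E)%E.
  by under eq_integral do rewrite normrM EFinM; rewrite ge0_integralZl_EFin.
have I0 j : (0 <= \int[mu]_x `|a j x|%:E)%E by exact: integral_ge0.
have bfin : (\sum_(0 <= j <oo) \int[mu]_x `|b j x|%:E < +oo)%E.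
  apply: (@le_lt_trans _ _ (2%:E * L)%E); last by rewrite -(fineK Lfin) -EFinM ltry.
  rewrite -nneseriesZl//; apply: lee_nneseries => [j _ _|j _]; first exact: integral_ge0.
  rewrite int_scale muleC; apply: lee_pmul => //.
    by apply: le_trans (a1 j) _; rewrite lee_fin ler_piMr.
  by rewrite lee_fin /lo; case: ifP; rewrite ?normr0.
have [f1 [if1 cvf1]] := l1_series mb bfin.
pose f2 x := f x - f1 x.
have if2 : mu.-integrable [set: 'rV[R]_n] (EFin \o f2).
  rewrite (_ : _ \o _ = fun x => (f x)%:E - (f1 x)%:E)%E; last first.
    by apply/funext => y /=; rewrite EFinB.
  exact: integrableB Lf if1.
have norm1 : (H1norm Phi f1 <= (K * m)%:E * L)%E.
  pose GG j x := (`|lo j|%:E * G j x)%E.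
  have GG0 j x : (0 <= GG j x)%E by rewrite mule_ge0.
  have mGG j : measurable_fun [set: 'rV[R]_n] (GG j) by exact: measurable_funeM.
  have bGG j x : (maximal_fun Phi (b j) x <= GG j x)%E.
    apply: le_trans (maximal_funZ_le _ _) _; last by apply: lee_wpmul2l.
    by move=> r r0; exact: integrable_dilateM (ia j).
  apply: (@le_trans _ _ (\int[mu]_x \sum_(0 <= j <oo) GG j x)%E).
    apply: lower_integral_le => x; first exact: maximal_fun_ge0.
    exact: maximal_fun_series mPhi PhiC' if1 ib cvf1 bGG x.
  rewrite integral_nneseries// -nneseriesZl//.
  apply: lee_nneseries => [j _ _|j _]; first exact: integral_ge0.
  rewrite ge0_integralZl//.
  rewrite /lo; case: ifPn => pt; last first.
    by rewrite normr0 mul0e mule_ge0// lee_fin mulr_ge0// ltW.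
  rewrite muleC; apply: lee_wpmul2r; first by rewrite lee_fin.
  apply: le_trans (iG j) _; rewrite lee_fin ler_wpM2l ?(ltW K0)//.
  exact: small_exponent_le.
have norm2 : (t%:E * L1norm f2 <= (2 * m)%:E * L)%E.
  apply: (@le_trans _ _
    (t%:E * \sum_(0 <= j <oo) (`|hi j|%:E * \int[mu]_x `|a j x|%:E))%E).
    apply: lee_wpmul2l; first by rewrite lee_fin ltW.
    pose A N x := f x - \sum_(j < N) lam j * a j x.
    pose B N x := f1 x - \sum_(j < N) b j x.
    have cvA : (\int[mu]_x `|A N x|%:E)%E @[N --> \oo] --> 0%E.
      apply: cvg_trans cvf; apply: near_eq_cvg; apply: nearW => N.
      by rewrite /L1norm Lnorm1.
    have mf : measurable_fun [set: 'rV[R]_n] f.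
      by apply/measurable_EFinP; exact: measurable_int Lf.
    have mf1 : measurable_fun [set: 'rV[R]_n] f1.
      by apply/measurable_EFinP; exact: measurable_int if1.
    have mA N : measurable_fun [set: 'rV[R]_n] (fun x => `|A N x|%:E).
      apply/measurable_EFinP; apply: measurableT_comp => //.
      apply: measurable_funB => //; apply: measurable_sum => j.
      exact: measurable_funM.
    have mB N : measurable_fun [set: 'rV[R]_n] (fun x => `|B N x|%:E).
      apply/measurable_EFinP; apply: measurableT_comp => //.
      by apply: measurable_funB => //; exact: measurable_sum.
    have mhi j : measurable_fun [set: 'rV[R]_n] (fun x => `|hi j * a j x|%:E).
      by apply/measurable_EFinP; apply: measurableT_comp => //; exact: measurable_funM.
    apply: (@le_cvg0D _ _ _ (fun N => \int[mu]_x `|A N x|%:E + \int[mu]_x `|B N x|%:E)%E).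
      by rewrite -[X in _ --> X](adde0 0%E); apply: cvgeD.
    move=> N; apply: (@le_trans _ _ (\int[mu]_x (`|A N x|%:E + `|B N x|%:E) +
        \sum_(0 <= j < N) \int[mu]_x `|hi j * a j x|%:E)%E).
      rewrite -ge0_integral_sum// -ge0_integralD//; last 4 first.
      - by move=> x _; rewrite adde_ge0.
      - exact: emeasurable_funD.
      - by move=> x _; exact: sume_ge0.
      - exact: emeasurable_sum.
      rewrite /L1norm Lnorm1; apply: ge0_le_integral => //.
      - apply: measurableT_comp => //; exact: measurable_int if2.
      - by apply: emeasurable_funD; [exact: emeasurable_funD|exact: emeasurable_sum].
      move=> x _; rewrite sumEFin -!EFinD abse_EFin lee_fin.
      have -> : f2 x = A N x - B N x + \sum_(0 <= j < N) hi j * a j x.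
        rewrite /A /B /f2 big_mkord.
        have -> : \sum_(j < N) lam j * a j x =
            \sum_(j < N) b j x + \sum_(j < N) hi j * a j x.
          rewrite -big_split/=; apply: eq_bigr => j _.
          by rewrite (lohi j) mulrDl.
        lra.
      apply: le_trans (ler_normD _ _) _; apply: lerD; first exact: ler_normB.
      exact: ler_norm_sum.
    rewrite ge0_integralD//; apply: leeD2l.
    under eq_bigr do rewrite int_scale.
    by apply: nneseries_lim_ge => j _ _; rewrite mule_ge0.
  rewrite -!nneseriesZl//; last by move=> j _; rewrite mule_ge0.
  apply: lee_nneseries => [j _ _|j _]; first by rewrite !mule_ge0// lee_fin ltW.
  rewrite /hi; case: ifPn => pt.
    by rewrite normr0 mul0e mule0 mule_ge0// lee_fin mulr_ge0.
  rewrite muleCA muleC; apply: lee_wpmul2r; first by rewrite lee_fin.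
  apply: (@le_trans _ _ (t%:E * (2 * (p j `^ s^-1)^-1)%:E)%E).
    by apply: lee_wpmul2l => //; rewrite lee_fin ltW.
  rewrite -EFinM lee_fin mulrCA ler_wpM2l//.
  by apply: large_exponent_le => //; rewrite ltW// ltNge.
have H1f1 : H1 Phi f1.
  split => //; apply: (le_lt_trans norm1).
  by rewrite -(fineK Lfin) -EFinM ltry.
apply: (@le_trans _ _ (H1norm Phi f1 + t%:E * L1norm f2)%E).
  apply: ereal_inf_lbound; exists f1, f2; split => //.
  by apply: aeW => x _; rewrite /f2 /= addrC subrK.
apply: le_trans (leeD norm1 norm2) _.
by rewrite -(fineK Lfin) -!EFinM -EFinD lee_fin; lra.
Qed.

End interpolation.

Unset Implicit Arguments.
Set Strict Implicit.
Set Printing Implicit Defensive.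

Theorem corollary2p1p1 (R : realType) (n : nat) (n_gt0 : (0 < n)%N)
    (Phi : 'rV[R]_n -> R) (Phi_schwartz : schwartz Phi)
    (Phi_int : (\int[lebesgue_rV n]_x (Phi x)%:E)%E <> 0%E)
    (s s' : R) (s_gt1 : 1 < s) (ss' : s^-1 + s'^-1 = 1) :
  exists c : R, forall f : 'rV[R]_n -> R, Xspace s f -> forall t : R, 0 < t ->
    (K_functional Phi t f <= (c * Num.min t (t `^ s'^-1))%:E * Xnorm s f)%E.
Proof.
have [c c0 hc] := K_functional_atomic_le Phi_schwartz s_gt1 ss'.
exists c => f [Lf _] t t0; set r := c * _.
have r0 : 0 < r by rewrite mulr_gt0// lt_min t0 powR_gt0.
rewrite -lee_pdivrMl//; apply: le_ereal_inf_tmp => _ [lam [a [dec ->]]].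
by rewrite lee_pdivrMl//; exact: hc dec.
Qed.
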